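(* Let $f(u)=u-u^q$ with $q\ge3$ an odd integer, where either $d=2$, or $d=3$ and $q\in\{3,5\}$; let $g\in C^1(\mathbb{R})$ be globally Lipschitz, and let $\{u_h^n\}_{n=0}^N$ be the solution of the fully discrete finite element scheme described in the context. Suppose the mesh assumption given in the context holds. Then for any real $p\ge2$ there is a constant $C>0$, independent of $h$ and $\tau$, such that $$\sup_{0\le \ell\le N}\mathbb{E}\bigl[\|u_h^\ell\|_{L^2}^p\bigr]\le C.$$
   Context: **Setting.** $\mathcal{D}\subset\mathbb{R}^d$ is a bounded domain, $T>0$, $(\Omega,\mathcal{F},\{\mathcal{F}_t\}_{t\ge0},\mathbb{P})$ is a filtered probability space carrying a standard real-valued Wiener process $W$, $\mathbb{E}$ is expectation, $(\cdot,\cdot)$ is the $L^2(\mathcal{D})$ inner product, and $\|\cdot\|_{L^2}=\|\cdot\|_{L^2(\mathcal{D})}$. The scheme approximates the SPDE $du=[\Delta u+f(u)]dt+g(u)dW(t)$ with $\partial u/\partial\nu=0$ on $\partial\mathcal{D}$ and $u(\cdot,0)=u_0$, where $f(u)=u-u^q$, $g\in C^1(\mathbb{R})$ satisfies $|g(a)-g(b)|\le\kappa_1|a-b|$ for all $a,b\in\mathbb{R}$ and some $\kappa_1>0$, and $u_0$ is a sufficiently smooth initial function. **Mesh.** $t_n=n\tau$, $n=0,\dots,N$, is a uniform partition of $[0,T]$ ($\tau=T/N$). $\mathcal{T}_h$ is a conforming, shape-regular simplicial triangulation of $\mathcal{D}$ of mesh size $h$. Mesh assumption: for every edge $E$ of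 the triangulation, $$\frac{1}{d(d-1)}\sum_{K\supset E}|\kappa_E^K|\cot\theta_E^K\ge0,$$ where the sum is over simplices $K\in\mathcal{T}_h$ containing $E$; if $a_1,\dots,a_{d+1}$ are the vertices of $K$, $E$ joins $a_i$ and $a_j$, and $F_i$ denotes the $(d-1)$-dimensional face of $K$ opposite $a_i$, then $\theta_E^K$ is the angle between $F_i$ and $F_j$, $\kappa_E^K=F_i\cap F_j$ is the $(d-2)$-dimensional simplex opposite to $E$, and $|\kappa_E^K|$ is its $(d-2)$-dimensional measure. **Scheme.** $V_h=\{v_h\in H^1(\mathcal{D}):v_h|_K\in\mathcal{P}_1(K)\ \forall K\in\mathcal{T}_h\}$. $I_h:C(\overline{\mathcal{D}})\to V_h$ is the nodal interpolation $I_hv=\sum_iv(a_i)\varphi_i$, with $\varphi_i$ the nodal basis function at vertex $a_i$. $P_h:L^2(\mathcal{D})\to V_h$ is the $L^2$-projection; it satisfies the standard estimates $\|w-P_hw\|_{L^2}+h\|\nabla(w-P_hw)\|_{L^2}\le Ch^{\min\{2,s\}}\|w\|_{H^s}$ for $w\in H^s(\mathcal{D})$ and $\|w-P_hw\|_{L^\infty}\le Ch^{2-d/2}\|w\|_{H^2}$. The discrete solution is an $\mathcal{F}_{t_n}$-adapted $V_h$-valued process $\{u_h^n\}$ with $u_h^0=P_hu_0$ such that, $\mathbb{P}$-almost surely, for $n=0,\dots,N-1$, $$(u_h^{n+1},v_h)+\tau(\nabla u_h^{n+1},\nabla v_h)=(u_h^n,v_h)+\tau(I_hf^{n+1},v_h)+(g(u_h^n),v_h)\,\bar\Delta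 W_{n+1}\quad\forall v_h\in V_h,$$ where $f^{n+1}=u_h^{n+1}-(u_h^{n+1})^q$ and $\bar\Delta W_{n+1}=W(t_{n+1})-W(t_n)$. *)

(* Defs.v *)
From HB Require Import structures.
From mathcomp Require Import all_boot all_order all_algebra.
From mathcomp Require Import all_classical all_reals all_analysis.

Set Implicit Arguments.
Unset Strict Implicit.
Unset Printing Implicit Defensive.

Import Order.TTheory GRing.Theory Num.Theory.
Import numFieldNormedType.Exports.

Local Open Scope classical_set_scope.
Local Open Scope ring_scope.

(* The product sigma-algebra on T^n; for T = R it is the Borel sigma-algebra. *)
Section row_vector_measurable.
Context {d} {T : measurableType d} (n : nat).

Let coor (i : 'I_n) (x : 'rV[T]_n) : T := x 0 i.

Let rV_set0 : g_sigma_preimage coor set0.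
Proof. exact: sigma_algebra0. Qed.

Let rV_setC A : g_sigma_preimage coor A -> g_sigma_preimage coor (~` A).
Proof. exact: sigma_algebraC. Qed.

Let rV_bigcup (F : (set 'rV[T]_n)^nat) :
  (forall i, g_sigma_preimage coor (F i)) ->
  g_sigma_preimage coor (\bigcup_i F i).
Proof. exact: sigma_algebra_bigcup. Qed.

HB.instance Definition _ := @isMeasurable.Build (measure_tuple_display d)
  'rV[T]_n (g_sigma_preimage coor) rV_set0 rV_setC rV_bigcup.

End row_vector_measurable.

Lemma measurable_coord d (T : measurableType d) n (i : 'I_n) :
  measurable_fun [set: 'rV[T]_n] (fun x => x 0 i).
Proof.
move=> _ Y mY; rewrite setTI; apply: sub_sigma_algebra => /=.
rewrite -bigcup_seq/=; exists i => /=; first by rewrite mem_index_enum.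
by exists Y => //; rewrite setTI.
Qed.

Lemma measurable_fun_rV d1 d2 (T1 : measurableType d1) (T2 : measurableType d2)
    n (f : T1 -> 'rV[T2]_n) :
  (forall i, measurable_fun [set: T1] (fun x => f x 0 i)) ->
  measurable_fun [set: T1] f.
Proof.
move=> mf _ A mA; rewrite setTI.
have : preimage_set_system setT f measurable `<=` @measurable _ T1.
  rewrite -[X in X `<=` _](@g_sigma_preimage_comp _ _ n 'rV[T2]_n (fun (i : 'I_n) x => x 0 i) _ f).
  apply: smallest_sub; first exact: sigma_algebra_measurable.
  rewrite -bigcup_seq/=; apply: bigcup_sub => i _ _ [B mB <-].
  exact: mf.
by apply; exists A => //; rewrite setTI.
Qed.

Section lebesgue_rV.
Context {R : realType}.

Definition cons_rV n (p : measurableTypeR R * 'rV[R]_n) : 'rV[R]_n.+1 :=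
  \row_i (if unlift ord0 i is Some j then p.2 0 j else p.1).

Definition uncons_rV n (x : 'rV[R]_n.+1) : measurableTypeR R * 'rV[R]_n :=
  (x 0 ord0, \row_j x 0 (lift ord0 j)).

Lemma cons_rVK n : cancel (@cons_rV n) (@uncons_rV n).
Proof.
case=> t y; congr pair; first by rewrite mxE unlift_none.
by apply/rowP => j; rewrite !mxE liftK.
Qed.

Lemma measurable_cons_rV n : measurable_fun setT (@cons_rV n).
Proof.
apply: measurable_fun_rV => i.
case: (unliftP ord0 i) => [j ->|->].
  rewrite (_ : (fun _ => _) = (fun y : 'rV[R]_n => y 0 j) \o snd).
    by apply: measurableT_comp => //; exact: measurable_coord.
  by apply/funext => p /=; rewrite mxE liftK.
rewrite (_ : (fun _ => _) = fst) //.
by apply/funext => p /=; rewrite mxE unlift_none.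
Qed.

Lemma measurable_uncons_rV n : measurable_fun setT (@uncons_rV n).
Proof.
apply/measurable_fun_pair; first exact: measurable_coord.
apply: measurable_fun_rV => i.
rewrite (_ : (fun _ => _) = (fun x : 'rV[R]_n.+1 => x 0 (lift ord0 i))).
  exact: measurable_coord.
by apply/funext => x; rewrite mxE.
Qed.


Section step.
Variables (n : nat) (mu : {sigma_finite_measure set 'rV[R]_n -> \bar R}).

Definition lebesgue_step : set 'rV[R]_n.+1 -> \bar R :=
  pushforward (lebesgue_measure \x mu)%E (@cons_rV n).

Let step0 : lebesgue_step set0 = 0%E.
Proof. by rewrite /lebesgue_step /pushforward preimage_set0 measure0. Qed.

Let step_ge0 A : (0 <= lebesgue_step A)%E.
Proof. exact/(@measure_ge0 _ _ _ (lebesgue_measure \x mu)%E). Qed.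

Let step_sigma_additive : semi_sigma_additive lebesgue_step.
Proof.
have mcons := @measurable_cons_rV n.
exact: measure_semi_sigma_additive.
Qed.

HB.instance Definition _ := isMeasure.Build _ _ _ lebesgue_step
  step0 step_ge0 step_sigma_additive.

Let step_sigma_finite : sigma_finite setT lebesgue_step.
Proof.
have /sigma_finiteP[F [TF ndF Foo]] :=
  sigma_finiteT (@lebesgue_measure R).
have /sigma_finiteP[G [TG ndG Goo]] := sigma_finiteT mu.
exists (fun k => @uncons_rV n @^-1` (F k `*` G k)).
  rewrite -preimage_bigcup (_ : \bigcup_k _ = setT) ?preimage_setT//.
  rewrite -subTset => -[t y] _.
  have [i _ Fi] : (\bigcup_k F k) t by rewrite -TF.
  have [j _ Gj] : (\bigcup_k G k) y by rewrite -TG.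
  exists (maxn i j) => //; split.
    by move: t Fi; exact/subsetPset/ndF/leq_maxl.
  by move: y Gj; exact/subsetPset/ndG/leq_maxr.
move=> k; have [mF Fk] := Foo k; have [mG Gk] := Goo k; split.
  rewrite -[X in measurable X]setTI; apply: measurable_uncons_rV => //.
  exact: measurableX.
rewrite /lebesgue_step /pushforward -comp_preimage.
rewrite (_ : _ \o _ = id) ?preimage_id; last first.
  by apply/funext => p; exact: cons_rVK.
by rewrite product_measure1E// lte_mul_pinfty// ge0_fin_numE.
Qed.

HB.instance Definition _ := Measure_isSigmaFinite.Build _ _ _ lebesgue_step
  step_sigma_finite.
End step.

(* d-dimensional Lebesgue measure, as the d-fold product of lebesgue_measure. *)
Fixpoint lebesgue_rV n : {sigma_finite_measure set 'rV[R]_n -> \bar R} :=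
  if n is m.+1 then lebesgue_step (lebesgue_rV m) else \d_(0 : 'rV[R]_0).

End lebesgue_rV.

Section euclid.
Context {R : realType} {d : nat}.
Implicit Types x y : 'rV[R]_d.

Definition dot x y : R := \sum_i x 0 i * y 0 i.

(* `|x| on 'rV[R]_d is the max norm, hence a separate Euclidean norm. *)
Definition enorm x : R := Num.sqrt (dot x x).

Definition angle x y : R := acos (dot x y / (enorm x * enorm y)).

(* m-dimensional measure of the simplex with the m.+1 vertices s, by the Gram
   determinant formula sqrt(det G) / m!; a single point has measure 1. *)
Definition simplex_measure (s : seq 'rV[R]_d) : R :=
  if s is a :: s' then
    let e := [seq b - a | b <- s'] in
    Num.sqrt (\det (\matrix_(i < size e, j < size e) dot e`_i e`_j))
      / (size e)`!%:R
  else 0.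

End euclid.

Definition cot {R : realType} (t : R) : R := cos t / sin t.

Section sobolev.
Context {R : realType} {d : nat}.
Variable D : set 'rV[R]_d.
Implicit Types v w : 'rV[R]_d -> R.

Definition L2 v : Prop :=
  measurable_fun D v /\
  (lebesgue_rV d).-integrable D (fun x => (v x ^+ 2)%:E).

Definition inner v w : R :=
  (\int[lebesgue_rV d]_(x in D) (v x * w x))%R.

Definition L2norm v : R := Num.sqrt (inner v v).

Definition partial (i : 'I_d) v : 'rV[R]_d -> R :=
  fun x => 'D_(delta_mx 0 i) v x.

Fixpoint Ck (k : nat) v : Prop :=
  if k is m.+1 then
    continuous v /\
    forall i, (forall x, derivable v x (delta_mx 0 i)) /\ Ck m (partial i v)
  else continuous v.

Definition test_function phi : Prop :=
  (forall k, Ck k phi) /\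
  exists K, [/\ compact K, K `<=` D & forall x, ~ K x -> phi x = 0].

Definition weak_partial (i : 'I_d) v w : Prop :=
  forall phi, test_function phi -> inner v (partial i phi) = - inner w phi.

Fixpoint sobolev (k : nat) v : Prop :=
  if k is m.+1 then
    L2 v /\ forall i, exists w, sobolev m w /\ weak_partial i v w
  else L2 v.

(* The weak partial derivative is unique up to a null set, which the inner
   product below does not see. *)
Definition weak_grad v (i : 'I_d) : 'rV[R]_d -> R :=
  get [set w | L2 w /\ weak_partial i v w].

Definition grad_inner v w : R :=
  \sum_i inner (weak_grad v i) (weak_grad w i).

End sobolev.

Definition bounded_domain {R : realType} {d : nat} (D : set 'rV[R]_d) : Prop :=
  [/\ open D, connected D, D !=set0 & bounded_set D].

Section simplices.
Context {R : realType} {d nv : nat}.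
Variable node : 'I_nv -> 'rV[R]_d.
Implicit Types K : {set 'I_nv}.

Definition supported K (c : 'I_nv -> R) : Prop := forall i, i \notin K -> c i = 0.

Definition simplex K : set 'rV[R]_d :=
  [set x | exists c, [/\ supported K c, forall i, 0 <= c i,
                         \sum_i c i = 1 & x = \sum_i c i *: node i]].

Definition affine_span K : set 'rV[R]_d :=
  [set x | exists c, [/\ supported K c,
                         \sum_i c i = 1 & x = \sum_i c i *: node i]].

Definition affinely_independent K : Prop :=
  forall c, supported K c -> \sum_i c i = 0 -> \sum_i c i *: node i = 0 ->
  forall i, c i = 0.

Definition diameter K : R :=
  sup [set r | exists x y, [/\ simplex K x, simplex K y & r = enorm (x - y)]].

Definition inball_diameter K : R :=
  sup [set r | 0 <= r /\
    exists x, [set y | enorm (y - x) <= r / 2] `<=` simplex K].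

(* Orthogonal projection of x onto the affine span of the vertices in K. *)
Definition foot K (x : 'rV[R]_d) : 'rV[R]_d :=
  get [set y | affine_span K y /\
    forall a b, a \in K -> b \in K -> dot (x - y) (node a - node b) = 0].

(* kappa_E^K = F_i :&: F_j, where F_i = K :\ i and E joins nodes i and j. *)
Definition opposite K (i j : 'I_nv) : {set 'I_nv} := (K :\ i) :&: (K :\ j).

Definition opposite_measure K i j : R :=
  simplex_measure [seq node k | k <- enum (opposite K i j)].

(* The (dihedral) angle between the faces F_i, which contains node j, and F_j,
   which contains node i: it is measured between the directions orthogonal to
   F_i :&: F_j inside the two faces. *)
Definition face_angle K i j : R :=
  let perp x := x - foot (opposite K i j) x in
  angle (perp (node j)) (perp (node i)).

End simplices.

(* Conforming simplicial triangulations of D.  A simplex is given by its set of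
   vertices.  The last field holds for every triangulated Lipschitz domain; it
   excludes sets D whose closure is the union of the simplices but from which a
   slit, or a nowhere dense set of positive measure, has been removed. *)
Record triangulation {R : realType} {d : nat} (D : set 'rV[R]_d) := Triangulation {
  nv : nat;
  node : 'I_nv -> 'rV[R]_d;
  cells : {set {set 'I_nv}};
  cells_cover_nodes : forall i, exists2 K, K \in cells & i \in K;
  cells_card : forall K, K \in cells -> #|K| = d.+1;
  cells_nondegenerate : forall K, K \in cells -> affinely_independent node K;
  cells_conforming : forall K L, K \in cells -> L \in cells ->
    simplex node K `&` simplex node L = simplex node (K :&: L);
  cells_cover : closure D = \bigcup_(K in [set` cells]) simplex node K;
  cells_interior : (\bigcup_(K in [set` cells]) simplex node K)° `<=` D
}.

Definition shape_regular {R : realType} {d : nat} {D : set 'rV[R]_d}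
    (Th : set (triangulation D)) : Prop :=
  exists gamma : R, forall M, Th M -> forall K, K \in cells M ->
    diameter (@node _ _ _ M) K <= gamma * inball_diameter (@node _ _ _ M) K.

Section finite_elements.
Context {R : realType} {d : nat} {D : set 'rV[R]_d}.
Variable M : triangulation D.

Local Notation node := (@node _ _ _ M).
Local Notation cells := (cells M).

Definition mesh_assumption : Prop :=
  forall i j, i != j -> (exists2 K, K \in cells & (i \in K) && (j \in K)) ->
  0 <= (d * (d - 1))%:R^-1 *
       \sum_(K in cells | (i \in K) && (j \in K))
          opposite_measure node K i j * cot (face_angle node K i j).

(* Elements of V_h are represented by functions affine on each closed simplex,
   hence continuous on the closure of D; their values elsewhere are irrelevant. *)
Definition piecewise_P1 (v : 'rV[R]_d -> R) : Prop :=
  forall K, K \in cells ->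
  exists (a : 'rV[R]_d) (b : R), forall x, simplex node K x -> v x = dot a x + b.

Definition Vh (v : 'rV[R]_d -> R) : Prop := sobolev D 1 v /\ piecewise_P1 v.

Definition nodal_basis (i : 'I_(nv M)) : 'rV[R]_d -> R :=
  get [set phi | piecewise_P1 phi /\ forall j, phi (node j) = (i == j)%:R].

Definition interpolant (v : 'rV[R]_d -> R) : 'rV[R]_d -> R :=
  fun x => \sum_i v (node i) * nodal_basis i x.

Definition L2_projection (w v : 'rV[R]_d -> R) : Prop :=
  Vh v /\ forall z, Vh z -> inner D v z = inner D w z.

End finite_elements.

Section stochastic.
Context {R : realType} {disp : measure_display} {Omega : measurableType disp}.

Definition filtration (F : R -> set (set Omega)) : Prop :=
  [/\ forall t, 0 <= t -> sigma_algebra setT (F t),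
      forall t, 0 <= t -> F t `<=` measurable &
      forall s t, 0 <= s -> s <= t -> F s `<=` F t].

Definition measurable_wrt (G : set (set Omega)) (X : Omega -> R) : Prop :=
  forall B : set R, measurable B -> G (X @^-1` B).

Definition increment (W : R -> Omega -> R) (s t : R) (w : Omega) : R :=
  W t w - W s w.

(* A standard Wiener process with respect to the filtration F; the second
   parameter of normal_prob is the standard deviation. *)
Record wiener (P : probability Omega R) (F : R -> set (set Omega))
    (W : R -> Omega -> R) : Prop := Wiener {
  wiener_adapted : forall t, 0 <= t -> measurable_wrt (F t) (W t);
  wiener_start : {ae P, forall w, W 0 w = 0};
  wiener_continuous : {ae P, forall w, {within `[0, +oo[, continuous (W ^~ w)}};
  wiener_gaussian : forall s t, 0 <= s -> s < t ->
    forall B : set R, measurable B ->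
    P (increment W s t @^-1` B) = normal_prob 0 (Num.sqrt (t - s)) B;
  wiener_independent : forall s t, 0 <= s -> s < t ->
    forall A (B : set R), F s A -> measurable B ->
    P (A `&` (increment W s t @^-1` B)) =
      (P A * P (increment W s t @^-1` B))%E
}.

Record scheme_solution {d : nat} {D : set 'rV[R]_d} (P : probability Omega R)
    (F : R -> set (set Omega)) (W : R -> Omega -> R) (q : nat) (g : R -> R)
    (u0 : 'rV[R]_d -> R) (T : R) (M : triangulation D) (N : nat)
    (u : nat -> Omega -> 'rV[R]_d -> R) : Prop := SchemeSolution {
  scheme_Vh : forall n w, (n <= N)%N -> Vh M (u n w);
  scheme_adapted : forall n x, (n <= N)%N -> closure D x ->
    measurable_wrt (F (n%:R * (T / N%:R))) (fun w => u n w x);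
  scheme_start : forall w, L2_projection M u0 (u 0%N w);
  scheme_step : {ae P, forall w, forall n, (n < N)%N -> forall v, Vh M v ->
    let tau := T / N%:R in
    let f := fun a : R => a - a ^+ q in
    inner D (u n.+1 w) v + tau * grad_inner D (u n.+1 w) v
    = inner D (u n w) v + tau * inner D (interpolant M (f \o u n.+1 w)) v
      + inner D (g \o u n w) v * increment W (n%:R * tau) (n.+1%:R * tau) w}
}.

End stochastic.

(* Main.v *)
(* Test the scheme with u^{n+1}: the gradient term is nonnegative, so everything
   rests on a bound from above of (I_h f(v), v), uniform in the mesh and in v in
   V_h.  On a simplex with barycentric coordinates l_i the integral of l_i l_j is
   (1 + delta_ij) alpha, hence the contribution of the simplex is alpha times a
   polynomial in the d + 1 nodal values of v.  Its leading part is minus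
     sum_{i,j} (1 + delta_ij) v_i^q v_j,
   which is negative definite exactly because of the restrictions on d and q, so
   the polynomial is bounded above and (I_h f(v), v) <= C |D|.  Whatever the size
   of tau, this yields
     |u^{n+1}|^2 <= |u^n|^2 + 2 tau C |D| + |g(u^n)|^2 dW^2 + 2 (g(u^n), u^n) dW.
   With X = 1 + |u|^2 the right-hand side is at most
   X (1 + K (tau + dW^2) + b dW), |b| <= K.  As dW is symmetric, independent of
   the past, and has even moments O(tau), raising to the power m multiplies the
   expectation by at most 1 + C tau, and (1 + C tau)^N <= exp(C T). *)

(* The restrictions on d and q come from counting. For three vertices the leading form is exactly
   the sum over pairs of (x + y) (x^q + y^q), nonnegative for every odd q. For four vertices that
   sum contains each x^(q+1) once too often, so q = 3 and q = 5 need their own arguments: a suitable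
   affine function of x turns each one-variable term into a nonnegative product, and the total of
   these affine functions over the four vertices depends only on the sum of the nodal values. The
   shape of the mass matrix is derived without a reference simplex or a change of variables.
   Translation along an edge preserves Lebesgue measure, so a directional derivative along that edge
   integrates to zero, and a good choice of the differentiated function gives the relation between
   diagonal and off-diagonal entries. In the probabilistic part integrability of the linear term in
   dW is not known beforehand. All expectations are therefore taken of nonnegative functions in the
   extended reals, and finiteness of the moment travels with the induction over the time steps. *)
Require Import Defs.
From mathcomp Require Import all_boot all_order all_algebra.
From mathcomp Require Import all_classical all_reals all_analysis.
From mathcomp Require Import measurable_realfun ring lra.

Set Implicit Arguments.
Unset Strict Implicit.
Unset Printing Implicit Defensive.

Import Order.TTheory GRing.Theory Num.Theory.
Import numFieldNormedType.Exports.

Local Open Scope classical_set_scope.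
Local Open Scope ring_scope.

(** * The local reaction inequality *)

(* Each of the two inequalities is needed for the induction step of the other. *)
Lemma odd_power_mean (R : realFieldType) (x y : R) k :
  4^-1 ^+ k * (x + y) ^+ k.*2.+2 <= (x + y) * (x ^+ k.*2.+1 + y ^+ k.*2.+1) /\
  0 <= (x - y) * (x ^+ k.*2.+1 - y ^+ k.*2.+1).
Proof.
elim: k => [|k [ih1 ih2]].
  by rewrite expr0 !expr1 mul1r -!expr2 sqr_ge0.
rewrite doubleS.
have pos0 : 0 <= 4^-1 ^+ k * (x + y) ^+ k.*2.+2.
  apply: mulr_ge0; first by rewrite exprn_ge0 ?invr_ge0.
  by rewrite -doubleS exprn_even_ge0 ?odd_double.
set A := x ^+ k.*2.+1 in ih1 ih2 *; set B := y ^+ k.*2.+1 in ih1 ih2 *.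
have -> : x ^+ k.*2.+3 = x ^+ 2 * A by rewrite /A !exprS; ring.
have -> : y ^+ k.*2.+3 = y ^+ 2 * B by rewrite /B !exprS; ring.
have -> : 4^-1 ^+ k.+1 * (x + y) ^+ k.*2.+4
   = (x + y) ^+ 2 / 4 * (4^-1 ^+ k * (x + y) ^+ k.*2.+2).
  by rewrite (exprS 4^-1) (exprD _ 2 k.*2.+2); ring.
have pos1 := le_trans pos0 ih1.
split; last first.
  (* Both identities come from 2 (x^2 A + y^2 B) = (x^2 + y^2) (A + B) + (x^2 - y^2) (A - B) and its
     counterpart for the difference; the factor x^2 - y^2 supplies what turns one product into the
     other. *)
  have -> : (x - y) * (x ^+ 2 * A - y ^+ 2 * B)
    = (x ^+ 2 + y ^+ 2) / 2 * ((x - y) * (A - B))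
      + (x - y) ^+ 2 / 2 * ((x + y) * (A + B)) by field.
  by rewrite addr_ge0 // mulr_ge0 ?divr_ge0 ?addr_ge0 ?sqr_ge0.
have -> : (x + y) * (x ^+ 2 * A + y ^+ 2 * B)
    = (x ^+ 2 + y ^+ 2) / 2 * ((x + y) * (A + B))
      + (x + y) ^+ 2 / 2 * ((x - y) * (A - B)) by field.
apply: ler_wpDr; first by rewrite mulr_ge0 ?divr_ge0 ?sqr_ge0.
apply: ler_pM => //; first by rewrite divr_ge0 ?sqr_ge0.
by have := sqr_ge0 (x - y); nra.
Qed.

(** Once t^2 exceeds both 1 and 1/c, c t^(2k) >= c t^2 >= 1 and the difference is nonpositive; below
    that threshold t^2 alone is bounded. *)
Lemma sqr_sub_power_bound (R : realFieldType) (c : R) k : 0 < c -> (0 < k)%N ->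
  exists C, forall t : R, t ^+ 2 - c * t ^+ k.*2.+2 <= C.
Proof.
move=> c0 k0; exists (Num.max 1 c^-1) => t.
have [h|h] := leP (t ^+ 2) (Num.max 1 c^-1).
  rewrite lerBlDr; apply: (le_trans h); rewrite lerDl; apply: mulr_ge0; first exact: ltW.
  by rewrite -doubleS exprn_even_ge0 ?odd_double.
have {h}[h1 h2] : 1 < t ^+ 2 /\ c^-1 < t ^+ 2 by apply/andP; rewrite -gt_max.
apply: (@le_trans _ _ 0); last by rewrite le_max ler01.
have -> : t ^+ k.*2.+2 = t ^+ 2 * t ^+ 2 ^+ k.
  by rewrite -exprM -exprD mul2n.
rewrite mulrCA -{1}[t ^+ 2]mulr1 -mulrBr mulr_ge0_le0 ?sqr_ge0// subr_le0.
have : t ^+ 2 <= t ^+ 2 ^+ k by rewrite ler_eXnr ?ltW.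
move=> h; rewrite -ler_pdivrMl// mulr1; exact/ltW/(lt_le_trans h2).
Qed.

(* The product is x^4 + s x^3 minus its tangent line at x = s / 4, as a function of x. *)
Lemma quartic_bound (R : realFieldType) (x s : R) :
  s ^+ 2 / 4 + x ^+ 2 -
    ((x - s / 4) ^+ 2 * ((x + 3 / 4 * s) ^+ 2 + s ^+ 2 / 8) + 5 / 256 * s ^+ 4) <= 12.
Proof.
set A := (x - s / 4) * (x + 3 / 4 * s).
have h0 : 0 <= (x - s / 4) ^+ 2 * (s ^+ 2 / 8) by rewrite mulr_ge0 ?divr_ge0 ?sqr_ge0.
have h1 : x ^+ 2 + s ^+ 2 / 4 <= 2 * A + 7 / 8 * s ^+ 2.
  have -> : 2 * A + 7 / 8 * s ^+ 2 = x ^+ 2 + s ^+ 2 / 4 + (x + s / 2) ^+ 2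
    by rewrite /A; field.
  by rewrite lerDl sqr_ge0.
have h2 : 2 * A - A ^+ 2 <= 1 by have := sqr_ge0 (A - 1); nra.
(* 112/5 is the vertex of the parabola 7/8 t - 5/256 t^2 in t = s^2, whose maximum 49/5 is rounded
   up to 11. *)
have h3 : 7 / 8 * s ^+ 2 - 5 / 256 * s ^+ 4 <= 11.
  have := sqr_ge0 (s ^+ 2 - 112 / 5).
  have -> : s ^+ 4 = s ^+ 2 * s ^+ 2 by ring.
  by set t := s ^+ 2; nra.
have -> : (x - s / 4) ^+ 2 * ((x + 3 / 4 * s) ^+ 2 + s ^+ 2 / 8)
    = A ^+ 2 + (x - s / 4) ^+ 2 * (s ^+ 2 / 8) by rewrite /A; ring.
lra.
Qed.

(* x^6 + 2 r x^5 - 2 r^5 x + r^6 = (w x)^2 (x^2 + r^2), where w x = 0 means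
   x + r / 2 = +- sqrt 5 / 2 r.  If all four w xi were small, the sum of the
   xi + r / 2 would be close to sqrt 5 / 2 r times an even integer, hence not 4 r. *)
Lemma sextic_gap (R : realFieldType) (x1 x2 x3 x4 r : R) (w : R -> R) : 0 < r ->
  x1 + x2 + x3 + x4 = 2 * r ->
  (forall x, w x = x ^+ 2 + r * x - r ^+ 2) ->
  400^-1 * r ^+ 4 <= w x1 ^+ 2 + w x2 ^+ 2 + w x3 ^+ 2 + w x4 ^+ 2.
Proof.
move=> r0 sx wE; rewrite leNgt; apply/negP => h.
(* Since w x = (x + r/2)^2 - 5/4 r^2, a value |w x| <= r^2/20 puts (x + r/2)^2 between 6/5 r^2 and
   13/10 r^2, so |x + r/2| lies between 1.09 r and 1.15 r. Four such numbers add up to at least 4.36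
   r if all are positive and to at most 2.36 r otherwise, while their sum is 4 r. *)
have key x : w x ^+ 2 < 400^-1 * r ^+ 4 ->
    (109 / 100 * r <= x + r / 2 <= 115 / 100 * r) \/
    (- (115 / 100) * r <= x + r / 2 <= - (109 / 100) * r).
  move=> hx.
  have {hx}[b1 b2] : - (r ^+ 2 / 20) <= w x /\ w x <= r ^+ 2 / 20.
    apply/andP; rewrite -ler_norml -ler_sqr ?nnegrE ?divr_ge0 ?sqr_ge0 ?normr_ge0//.
    rewrite real_normK ?num_real//; apply: (le_trans (ltW hx)).
    by rewrite [leRHS](_ : _ = 400^-1 * r ^+ 4) //; field.
  have [z0|z0] := leP 0 (x + r / 2); [left|right].
  - apply/andP; split; rewrite leNgt; apply/negP => hz; move: b1 b2; rewrite wE; nra.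
  - apply/andP; split; rewrite leNgt; apply/negP => hz; move: b1 b2; rewrite wE; nra.
have p1 := sqr_ge0 (w x1); have p2 := sqr_ge0 (w x2).
have p3 := sqr_ge0 (w x3); have p4 := sqr_ge0 (w x4).
have k1 : w x1 ^+ 2 < 400^-1 * r ^+ 4 by move: h p1 p2 p3 p4; lra.
have k2 : w x2 ^+ 2 < 400^-1 * r ^+ 4 by move: h p1 p2 p3 p4; lra.
have k3 : w x3 ^+ 2 < 400^-1 * r ^+ 4 by move: h p1 p2 p3 p4; lra.
have k4 : w x4 ^+ 2 < 400^-1 * r ^+ 4 by move: h p1 p2 p3 p4; lra.
move/key: k1 => k1; move/key: k2 => k2; move/key: k3 => k3; move/key: k4 => k4.
clear p1 p2 p3 p4 h key wE w.
by case: k1 => /andP[? ?]; case: k2 => /andP[? ?]; case: k3 => /andP[? ?];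
  case: k4 => /andP[? ?]; lra.
Qed.

(** Half of the leading form pays for x^2 up to a multiple of r^2: x^2 <= 2 w + 3 r^2, and w^2/2
    absorbs 2 w as soon as x^2 + r^2 >= 1. The other half is kept for r^2. *)
Lemma sextic_bound (R : realFieldType) (x r w : R) : w = x ^+ 2 + r * x - r ^+ 2 ->
  x ^+ 2 + r ^+ 2 - w ^+ 2 * (x ^+ 2 + r ^+ 2) / 2 <= 4 * r ^+ 2 + 4.
Proof.
move=> wE; have x2 : x ^+ 2 <= 2 * w + 3 * r ^+ 2.
  have -> : 2 * w + 3 * r ^+ 2 = x ^+ 2 + (x + r) ^+ 2 by rewrite wE; ring.
  by rewrite lerDl sqr_ge0.
have := sqr_ge0 (w - 2); have := sqr_ge0 (x - r); have := sqr_ge0 (x + r).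
have := sqr_ge0 w; have := sqr_ge0 x; have := sqr_ge0 r.
have [h|h] := leP 1 (x ^+ 2 + r ^+ 2).
  have : w ^+ 2 <= w ^+ 2 * (x ^+ 2 + r ^+ 2) by rewrite ler_peMr ?sqr_ge0.
  lra.
have : 0 <= w ^+ 2 * (x ^+ 2 + r ^+ 2) by rewrite mulr_ge0 ?addr_ge0 ?sqr_ge0.
lra.
Qed.

(** With s the sum of the variables, the leading form is the sum of x^4 + s x^3 over the four of
    them. The tangent lines at the mean s/4 have a common slope, so their linear parts cancel in the
    sum and only the values 5/256 s^4 remain; 48 = 4 * 12. *)
Lemma cubic4_bound (R : realFieldType) (x y z t : R) :
  (x - x ^+ 3 + (y - y ^+ 3) + (z - z ^+ 3) + (t - t ^+ 3)) * (x + y + z + t)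
   + ((x - x ^+ 3) * x + (y - y ^+ 3) * y + (z - z ^+ 3) * z + (t - t ^+ 3) * t) <= 48.
Proof.
pose s := x + y + z + t.
have := quartic_bound x s; have := quartic_bound y s.
have := quartic_bound z s; have := quartic_bound t s.
rewrite [X in _ -> _ -> _ -> _ -> X <= _](_ : _ =
   (s ^+ 2 / 4 + x ^+ 2 - ((x - s / 4) ^+ 2 * ((x + 3 / 4 * s) ^+ 2 + s ^+ 2 / 8)
      + 5 / 256 * s ^+ 4)) +
   (s ^+ 2 / 4 + y ^+ 2 - ((y - s / 4) ^+ 2 * ((y + 3 / 4 * s) ^+ 2 + s ^+ 2 / 8)
      + 5 / 256 * s ^+ 4)) +
   (s ^+ 2 / 4 + z ^+ 2 - ((z - s / 4) ^+ 2 * ((z + 3 / 4 * s) ^+ 2 + s ^+ 2 / 8)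
      + 5 / 256 * s ^+ 4)) +
   (s ^+ 2 / 4 + t ^+ 2 - ((t - s / 4) ^+ 2 * ((t + 3 / 4 * s) ^+ 2 + s ^+ 2 / 8)
      + 5 / 256 * s ^+ 4))); last by rewrite /s; field.
lra.
Qed.

(** With 2 r the sum of the variables, the leading form is the sum of x^6 + 2 r x^5, and the added
    terms r^6 - 2 r^5 x cancel over four variables. Hence it equals [Q], a sum of nonnegative
    products. *)
Lemma quintic4_bound (R : realFieldType) : exists C : R, forall x y z t : R,
  (x - x ^+ 5 + (y - y ^+ 5) + (z - z ^+ 5) + (t - t ^+ 5)) * (x + y + z + t)
   + ((x - x ^+ 5) * x + (y - y ^+ 5) * y + (z - z ^+ 5) * z + (t - t ^+ 5) * t) <= C.
Proof.
(* The half of [Q] left by [sextic_bound] is at least r^6/800 and must beat 16 r^2; dividing by 16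
   gives the coefficient 1/(400 * 32). *)
have c0 : 0 < 400^-1 / 32 :> R by rewrite divr_gt0 ?invr_gt0 ?ltr0n.
have [C0 hC0] := @sqr_sub_power_bound R _ 2 c0 isT.
exists (16 * `|C0| + 16) => x y z t; pose r := (x + y + z + t) / 2.
pose w a := a ^+ 2 + r * a - r ^+ 2.
pose Q := w x ^+ 2 * (x ^+ 2 + r ^+ 2) + w y ^+ 2 * (y ^+ 2 + r ^+ 2)
  + w z ^+ 2 * (z ^+ 2 + r ^+ 2) + w t ^+ 2 * (t ^+ 2 + r ^+ 2).
have hx := @sextic_bound R x r _ erefl; have hy := @sextic_bound R y r _ erefl.
have hz := @sextic_bound R z r _ erefl; have ht := @sextic_bound R t r _ erefl.
have hQ : 400^-1 * r ^+ 6 <= Q.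
  have Qge : r ^+ 2 * (w x ^+ 2 + w y ^+ 2 + w z ^+ 2 + w t ^+ 2) <= Q.
    rewrite -subr_ge0 (_ : _ - _ = (w x * x) ^+ 2 + (w y * y) ^+ 2
      + (w z * z) ^+ 2 + (w t * t) ^+ 2); last by rewrite /Q; ring.
    by rewrite !addr_ge0 ?sqr_ge0.
  apply: le_trans Qge; rewrite (_ : 400^-1 * r ^+ 6 = r ^+ 2 * (400^-1 * r ^+ 4)); last by ring.
  apply: ler_wpM2l; first exact: sqr_ge0.
  have [r0|r0|r0] := ltgtP r 0.
  - have := @sextic_gap R (- x) (- y) (- z) (- t) (- r) (fun a => w (- a)).
    rewrite !opprK; rewrite (_ : (- r) ^+ 4 = r ^+ 4); last by ring.
    apply; first by rewrite oppr_gt0.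
    + by rewrite /r; field.
    + by move=> a; rewrite /w; ring.
  - by apply: sextic_gap => //; rewrite /r; field.
  - by rewrite r0 expr0n/= mulr0 !addr_ge0 ?sqr_ge0.
have hr : 16 * r ^+ 2 - 400^-1 / 2 * r ^+ 6 <= 16 * `|C0|.
  have : r ^+ 2 - 400^-1 / 32 * r ^+ 6 <= C0 := hC0 r.
  have := ler_norm C0; lra.
rewrite (_ : _ + _ = 4 * r ^+ 2 + (x ^+ 2 + y ^+ 2 + z ^+ 2 + t ^+ 2) - Q); last first.
  by rewrite /Q /w /r; field.
move: hx hy hz ht hQ hr; rewrite /Q -/(w x) -/(w y) -/(w z) -/(w t); lra.
Qed.

(** For exactly three variables (sum x) (sum x^q) + sum x^(q+1) is the sum over the three pairs of
    (x + y) (x^q + y^q), and the quadratic part is likewise the sum of the (x + y)^2. Each pair then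
    contributes at most C. *)
Lemma planar_bound (R : realFieldType) q : odd q -> (3 <= q)%N ->
  exists C : R, forall x y z : R,
  (x - x ^+ q + (y - y ^+ q) + (z - z ^+ q)) * (x + y + z)
   + ((x - x ^+ q) * x + (y - y ^+ q) * y + (z - z ^+ q) * z) <= C.
Proof.
move=> oq q3; pose k := q./2.
have qE : q = k.*2.+1 by rewrite -[LHS]odd_double_half oq.
have k0 : (0 < k)%N by move: q3; rewrite qE; case: (k).
have [|C hC] := @sqr_sub_power_bound R (4^-1 ^+ k) k _ k0; first by rewrite exprn_gt0 ?invr_gt0.
exists (3 * C) => x y z; rewrite qE.
have [hxy _] := odd_power_mean x y k; have [hyz _] := odd_power_mean y z k.
have [hxz _] := odd_power_mean x z k.
have := hC (x + y); have := hC (y + z); have := hC (x + z).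
move: hxy hyz hxz; set A := x ^+ _; set B := y ^+ _; set D := z ^+ _.
nra.
Qed.

Lemma simplex_reaction_bound (R : realFieldType) d q :
  (3 <= q)%N -> odd q -> d = 2%N \/ (d = 3%N /\ (q = 3%N \/ q = 5%N)) ->
  exists C : R, forall (I : finType) (K : {set I}) (v : I -> R), #|K| = d.+1 ->
    \sum_(i in K) \sum_(j in K) (1 + (i == j)%:R) * ((v i - v i ^+ q) * v j) <= C.
Proof.
move=> q3 oq hd.
(* Splitting the weight 1 + delta_ij leaves a product of sums plus a diagonal sum; as sums over a
   list of length d + 1 they unfold to three or four explicit variables. *)
suff [C hC] : exists C : R, forall s : seq R, size s = d.+1 ->
    (\sum_(x <- s) (x - x ^+ q)) * (\sum_(x <- s) x)
     + \sum_(x <- s) (x - x ^+ q) * x <= C.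
  exists C => I K v cK; have := hC [seq v i | i <- enum K].
  rewrite size_map -cardE !big_map !big_enum/= => /(_ cK); apply: le_trans.
  rewrite mulr_suml -big_split/=; apply: ler_sum => i iK.
  under eq_bigr do rewrite mulrDl mul1r.
  rewrite big_split/= -mulr_sumr lerD2l (bigD1 i)//= eqxx mul1r.
  by rewrite big1 ?addr0// => j /andP[_ /negbTE ji]; rewrite eq_sym ji mul0r.
case: hd => [->|[-> [->|->]]].
- have [C hC] := planar_bound R oq q3; exists C => -[|x[|y[|z[|]]]]// _.
  by rewrite !big_cons !big_nil !addr0; move: (hC x y z); rewrite !addrA.
- exists 48 => -[|x[|y[|z[|t[|]]]]]// _; rewrite !big_cons !big_nil !addr0.
  by move: (cubic4_bound x y z t); rewrite !addrA.
- have [C hC] := quintic4_bound R; exists C => -[|x[|y[|z[|t[|]]]]]// _.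
  by rewrite !big_cons !big_nil !addr0; move: (hC x y z t); rewrite !addrA.
Qed.

(** * Lebesgue measure on row vectors *)

Lemma lebesgue_measure_shift (R : realType) (a : R) (A : set R) : measurable A ->
  lebesgue_measure ((fun x => x + a) @^-1` A) = lebesgue_measure A.
Proof.
have mf : @measurable_fun _ _ (measurableTypeR R) (measurableTypeR R) setT (fun x => x + a).
  exact: measurable_funD.
move=> mA; symmetry.
pose m : {measure set (measurableTypeR R) -> \bar R} :=
  measure_function_pushforward__canonical__measure_function_Measure lebesgue_measure mf.
apply: (@lebesgue_measure_unique R m) => // X [[u v] _ <-] /=.
have e : (fun x : R => x + a) @^-1` `]u, v] = `]u - a, v - a]%classic.
  by apply/seteqP; split => x /=; rewrite !in_itv/= ltrBlDr lerBrDr.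
rewrite /m /= /pushforward e !lebesgue_measure_itv/= !lte_fin ltrD2r.
by case: ifP => // _; rewrite -!EFinB; congr (_%:E); ring.
Qed.

Definition shiftrV (R : realType) n (v x : 'rV[R]_n) := x + v.

Lemma measurable_shiftrV (R : realType) n (v : 'rV[R]_n) : measurable_fun setT (shiftrV v).
Proof.
apply: measurable_fun_rV => i.
under eq_fun do rewrite mxE.
apply: measurable_funD => //; exact: measurable_coord.
Qed.

(** Through [cons_rV] the translation acts separately on the first coordinate and on the rest, and a
    product measure is determined by its values on rectangles. *)
Lemma lebesgue_rV_shift (R : realType) n (v : 'rV[R]_n) (A : set 'rV[R]_n) : measurable A ->
  lebesgue_rV n (shiftrV v @^-1` A) = lebesgue_rV n A.
Proof.
elim: n v A => [|n IH] v A mA.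
  rewrite /shiftrV (_ : _ @^-1` _ = A)//.
  by apply/seteqP; split => x; rewrite /= [v]thinmx0 addr0.
rewrite /=/lebesgue_step/pushforward.
pose a := v 0 ord0; pose w : 'rV[R]_n := \row_j v 0 (lift ord0 j).
pose phi (p : measurableTypeR R * 'rV[R]_n) : measurableTypeR R * 'rV[R]_n :=
  (p.1 + a, shiftrV w p.2).
have mphi : measurable_fun setT phi.
  apply/measurable_fun_pair.
    by apply: measurable_funD => //; exact: measurable_fst.
  apply: measurableT_comp; [exact: measurable_shiftrV|exact: measurable_snd].
have -> : cons_rV (n:=n) @^-1` (shiftrV v @^-1` A) = phi @^-1` (cons_rV (n:=n) @^-1` A).
  apply/funext => -[t y]; congr (A _).
  apply/rowP => i; rewrite !mxE /=; case: unliftP => [j ->|->] //=.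
  by rewrite !mxE.
have mB : measurable (cons_rV (n:=n) @^-1` A).
  by rewrite -[X in measurable X]setTI; exact: measurable_cons_rV.
set B := _ @^-1` A in mB *; symmetry.
pose m := measure_function_pushforward__canonical__measure_function_Measure
  (lebesgue_measure \x lebesgue_rV n)%E mphi.
rewrite (@product_measure_unique _ _ _ _ _ _ _ m)// => X Y mX mY.
rewrite /m /= /pushforward.
rewrite (_ : phi @^-1` _ = ((fun x => x + a) @^-1` X) `*` (shiftrV w @^-1` Y))//.
rewrite product_measure1E.
- by congr (_ * _)%E; [exact: lebesgue_measure_shift|exact: IH].
- by rewrite -[X in measurable X]setTI; apply: measurable_funD.
- by rewrite -[X in measurable X]setTI; apply: measurable_shiftrV.
Qed.

Lemma measurable_set_le d (T : measurableType d) (R : realType) (f : T -> R) r :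
  measurable_fun setT f -> measurable [set x | f x <= r].
Proof.
move=> mf; have := mf measurableT _ (measurable_itv `]-oo, r]); rewrite setTI.
by congr measurable; apply/seteqP; split => x /=; rewrite in_itv.
Qed.

Lemma measurable_set_ge d (T : measurableType d) (R : realType) (f : T -> R) r :
  measurable_fun setT f -> measurable [set x | r <= f x].
Proof.
move=> mf; have := mf measurableT _ (measurable_itv `[r, +oo[); rewrite setTI.
by congr measurable; apply/seteqP; split => x /=; rewrite in_itv/= andbT.
Qed.

Lemma measurable_set_lt d (T : measurableType d) (R : realType) (f : T -> R) r :
  measurable_fun setT f -> measurable [set x | f x < r].
Proof.
move=> mf; have := mf measurableT _ (measurable_itv `]-oo, r[); rewrite setTI.
by congr measurable; apply/seteqP; split => x /=; rewrite in_itv.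
Qed.

Definition cube (R : realType) n (r : R) : set 'rV[R]_n := [set x | forall i, `|x 0 i| <= r].

Lemma measurable_cube (R : realType) n (r : R) : measurable (@cube R n r).
Proof.
rewrite (_ : cube r = \bigcap_(i in [set: 'I_n]) [set x : 'rV[R]_n | `|x 0 i| <= r]).
  apply: fin_bigcap_measurable => // i _.
  by apply: measurable_set_le; apply: measurableT_comp => //; exact: measurable_coord.
by apply/seteqP; split => [x h i _|x h i]; exact: h.
Qed.

Lemma lebesgue_rV_cube (R : realType) n (r : R) : 0 <= r ->
  (lebesgue_rV n (cube r) < +oo)%E.
Proof.
move=> r0; elim: n => [|n IH].
  rewrite /= diracE; case: (_ \in _) => //=; exact: ltry.
rewrite /=/lebesgue_step/pushforward.
rewrite (_ : _ @^-1` _ = `[- r, r]%classic `*` cube r).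
  rewrite product_measure1E//; last exact: measurable_cube.
  apply: lte_mul_pinfty => //; rewrite ge0_fin_numE//.
  have : (@lebesgue_measure R `[(- r)%R, r] < +oo)%E; last by [].
  by rewrite lebesgue_measure_itv/=; case: ifP => // _; rewrite -EFinB ltry.
apply/seteqP; split => -[t y] /=.
  move=> h; split.
    by have := h ord0; rewrite mxE unlift_none in_itv/= ler_norml.
  by move=> i; have := h (lift ord0 i); rewrite mxE liftK.
rewrite in_itv/= -ler_norml => -[h1 h2] i; rewrite mxE.
by case: unliftP => [j|] _ /=.
Qed.

(** Row vectors carry the product sigma-algebra; open sets belong to it because they are countable
    unions of boxes with rational centres and radii 1/(k + 1). *)
Lemma measurable_open_rV (R : realType) n (A : set 'rV[R]_n) : open A -> measurable A.
Proof.
move=> oA.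
pose box (c : 'rV[rat]_n) (k : nat) : set 'rV[R]_n :=
  [set x | forall i, `|x 0 i - ratr (c 0 i)| < k.+1%:R^-1].
have mbox c k : measurable (box c k).
  rewrite (_ : box c k = \bigcap_(i in [set: 'I_n]) [set x : 'rV[R]_n | `|x 0 i - ratr (c 0 i)| < k.+1%:R^-1]).
    apply: fin_bigcap_measurable => // i _.
    apply: measurable_set_lt; apply: measurableT_comp => //.
    by apply: measurable_funB => //; exact: measurable_coord.
  by apply/seteqP; split => [x h i _|x h i]; exact: h.
(* Codes that denote no box, or a box not inside A, contribute the empty set. *)
pose F k := if unpickle k is Some (c, l) then
  if `[< box c l `<=` A >] then box c l else set0 else set0.
suff -> : A = \bigcup_k F k.
  apply: bigcup_measurable => k _; rewrite /F.
  by case: unpickle => [[c l]|//]; case: ifP.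
apply/seteqP; split => [x Ax|x [k _]]; last first.
  by rewrite /F; case: unpickle => [[c l]|//]; case: asboolP => // h /h.
have /nbhs_ballP[e /= e0 he] : nbhs x A by apply: open_nbhs_nbhs.
pose k := Num.truncn (2 / e).
have ke : k.+1%:R^-1 < e / 2.
  by rewrite -[ltRHS]invrK ltf_pV2 ?posrE ?invr_gt0 ?divr_gt0 ?ltr0n// invf_div truncnS_gt.
have rc i : exists c : rat, `|x 0 i - ratr c| < k.+1%:R^-1.
  have [|c] := @rat_in_itvoo R (x 0 i - k.+1%:R^-1) (x 0 i + k.+1%:R^-1).
    by rewrite ltrD2l gtrN// invr_gt0.
  rewrite in_itv/= => /andP[h1 h2]; exists c.
  rewrite ltr_norml; move: h1 h2; move: (k.+1%:R^-1) => t h1 h2; apply/andP; split; lra.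
have [c hc] := choice rc; pose cr : 'rV[rat]_n := \row_i c i.
exists (pickle (cr, k)) => //; rewrite /F pickleK.
rewrite asboolT; first by move=> i; rewrite mxE.
move=> y hy; apply: he; split => // i j; rewrite (ord1 i) /ball/=.
have := hc j; have := hy j; rewrite mxE => h1 h2.
rewrite (_ : _ - _ = (x 0 j - ratr (c j)) - (y 0 j - ratr (c j))); last by ring.
apply: (le_lt_trans (ler_normB _ _)).
by rewrite [ltRHS](splitr e) ltrD// (lt_trans _ ke).
Qed.

Lemma ge0_integral_rV_shift (R : realType) n (v : 'rV[R]_n) (f : 'rV[R]_n -> \bar R) :
  measurable_fun setT f -> (forall x, 0 <= f x)%E ->
  (\int[lebesgue_rV n]_x f (shiftrV v x) = \int[lebesgue_rV n]_x f x)%E.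
Proof.
move=> mf f0; have mv := measurable_shiftrV v.
have := @ge0_integral_pushforward _ _ _ _ R _ mv (lebesgue_rV n) setT f measurableT mf.
rewrite preimage_setT => <-; last by move=> x _; exact: f0.
apply: eq_measure_integral => A mA _; exact: lebesgue_rV_shift.
Qed.

(** * Barycentric coordinates *)

(** The coordinates are affine on the whole space, so they can be evaluated at translated points
    outside the simplex, and they are indexed by all nodes of the mesh, with value 0 off K, so that
    different cells can be compared. *)
Definition barycentric {R : realType} {d nv} (node : 'I_nv -> 'rV[R]_d) (K : {set 'I_nv})
    (l : 'I_nv -> 'rV[R]_d -> R) : Prop :=
  [/\ forall i, exists a b, forall x, l i x = dot a x + b,
      forall x, supported K (l ^~ x),
      forall x, \sum_i l i x = 1 &
      forall x, \sum_i l i x *: node i = x].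

(** Affine independence says that the vertices, each extended by an entry 1, are linearly
    independent rows. The matrix of these d + 1 rows is square, hence has an inverse B, and the
    coordinates of x are the entries of (x, 1) B. *)
Lemma barycentric_exists (R : realType) d nv (node : 'I_nv -> 'rV[R]_d) (K : {set 'I_nv}) :
  affinely_independent node K -> #|K| = d.+1 -> exists l, barycentric node K l.
Proof.
move=> indep cK.
pose N : 'M[R]_(#|K|, d + 1) := \matrix_(k, j) (row_mx (node (enum_val k)) (1 : 'rV_1)) 0 j.
have combE (u : 'rV_#|K|) : u *m N =
    row_mx (\sum_k u 0 k *: node (enum_val k)) (\sum_k u 0 k)%:M.
  apply/rowP => j; rewrite mxE; case: (split_ordP j) => {j} j ->.
    rewrite row_mxEl summxE; apply: eq_bigr => k _.
    by rewrite [N _ _]mxE row_mxEl mxE.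
  rewrite row_mxEr (ord1 j) mxE eqxx mulr1n; apply: eq_bigr => k _.
  by rewrite [N _ _]mxE row_mxEr mxE eqxx mulr1.
(* Extension by 0 from the enumeration of K to all nodes: the sum has one term for i in K and none
   otherwise. *)
pose lift (c : 'I_#|K| -> R) (i : 'I_nv) := \sum_(k | enum_val k == i) c k.
have lift_sum (V : lmodType R) (c : 'I_#|K| -> R) (F : 'I_nv -> V) :
    \sum_i lift c i *: F i = \sum_k c k *: F (enum_val k).
  rewrite (partition_big (fun k : 'I_#|K| => enum_val k) predT) //=.
  apply: eq_bigr => i _; rewrite /lift scaler_suml.
  by apply: eq_bigr => k /eqP ->.
have lift_supp c : supported K (lift c).
  move=> i iK; rewrite /lift big_pred0// => k; apply: contraNF iK => /eqP <-.
  exact: enum_valP.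
have Nfree : row_free N.
  apply: inj_row_free => u; rewrite combE => h.
  have u1 := congr1 lsubmx h; rewrite row_mxKl linear0 in u1.
  have u2 := congr1 rsubmx h; rewrite row_mxKr linear0 in u2.
  have s0 : \sum_k u 0 k = 0 by move/matrixP/(_ 0 0) : u2; rewrite !mxE eqxx mulr1n.
  have l0 := indep (lift (u 0)) (lift_supp _).
  apply/rowP => k; rewrite mxE -(l0 _ _ (enum_val k)); first last.
  - by rewrite lift_sum.
  - have := lift_sum R^o (u 0) (fun=> 1).
    by under eq_bigr do rewrite /GRing.scale/= mulr1; under [RHS]eq_bigr do rewrite /GRing.scale/= mulr1; rewrite s0.
  - rewrite /lift (big_pred1 k)// => k'.
    by apply/eqP/eqP => [/enum_val_inj|->].
have /row_fullP[B BN] : row_full N by rewrite /row_full (eqP Nfree) cK addn1.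
pose c x : 'rV_#|K| := row_mx x (1 : 'rV_1) *m B.
have cN x : c x *m N = row_mx x 1 by rewrite -mulmxA BN mulmx1.
exists (fun i x => lift (c x 0) i); split => [i|x|x|x].
- exists (\row_j \sum_(k | enum_val k == i) B (lshift 1 j) k).
  exists (\sum_(k | enum_val k == i) B (rshift d 0) k) => x.
  rewrite /dot; under eq_bigr do rewrite mxE mulr_suml.
  rewrite exchange_big -big_split/=; apply: eq_bigr => k _.
  rewrite /c mxE big_split_ord/= big_ord1 row_mxEr mxE eqxx mul1r; congr (_ + _).
  by apply: eq_bigr => j _; rewrite row_mxEl mulrC.
- exact: lift_supp.
- have := cN x; rewrite combE => /eq_row_mx[_ /matrixP/(_ 0 0)]; rewrite !mxE eqxx !mulr1n => <-.
  have := lift_sum R^o (c x 0) (fun=> 1).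
  by under eq_bigr do rewrite /GRing.scale/= mulr1; under [RHS]eq_bigr do rewrite /GRing.scale/= mulr1.
- by rewrite lift_sum; have := cN x; rewrite combE => /eq_row_mx[].
Qed.

Lemma ler_coord_norm (R : realType) n (x : 'rV[R]_n) k : `|x 0 k| <= `|x|.
Proof.
rewrite [leRHS]mx_normrE; exact: (le_bigmax _ (fun i => `|x i.1 i.2|) (0, k)).
Qed.

Section barycentric.
Context {R : realType} {d nv : nat} (node : 'I_nv -> 'rV[R]_d) (K : {set 'I_nv}).
Hypothesis indep : affinely_independent node K.
Variable l : 'I_nv -> 'rV[R]_d -> R.
Hypothesis lK : barycentric node K l.

Lemma barycentric_unique c x : supported K c -> \sum_i c i = 1 ->
  \sum_i c i *: node i = x -> forall i, c i = l i x.
Proof.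
case: lK => _ ls l1 lx cs c1 cx i; apply/eqP; rewrite -subr_eq0; apply/eqP.
apply: (indep (c := fun i => c i - l i x)) => [k kK||].
- by rewrite cs// ls// subr0.
- by rewrite sumrB c1 l1 subrr.
- by under eq_bigr do rewrite scalerBl; rewrite sumrB cx lx subrr.
Qed.

Lemma simplexP x : simplex node K x <-> forall i, 0 <= l i x.
Proof.
case: (lK) => _ ls l1 lx; split => [[c [cs c0 c1 cx]] i|h].
  by rewrite -(barycentric_unique cs c1 (esym cx)).
by exists (l ^~ x); split => //; rewrite lx.
Qed.

Lemma barycentric_node i k : i \in K -> l k (node i) = (k == i)%:R.
Proof.
move=> iK; symmetry; apply: (barycentric_unique (c := fun k => (k == i)%:R)).
- by move=> j; case: eqP => // ->; rewrite iK.
- by rewrite (bigD1 i)//= eqxx big1 ?addr0// => j /negbTE ->.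
- by rewrite (bigD1 i)//= eqxx scale1r big1 ?addr0// => j /negbTE ->; rewrite scale0r.
Qed.

Lemma barycentric_shift i j t k x : i \in K -> j \in K ->
  l k (shiftrV (t *: (node i - node j)) x) = l k x + t * ((k == i)%:R - (k == j)%:R).
Proof.
move=> iK jK; case: lK => _ ls l1 lx; symmetry.
apply: (barycentric_unique (c := fun k => l k x + t * ((k == i)%:R - (k == j)%:R))).
- move=> m mK; rewrite ls//.
  have -> : (m == i) = false by apply: contraNF mK => /eqP ->.
  have -> : (m == j) = false by apply: contraNF mK => /eqP ->.
  by rewrite subrr mulr0 addr0.
- rewrite big_split/= l1 -mulr_sumr sumrB.
  rewrite (bigD1 i)//= eqxx big1 ?addr0; last by move=> m /negbTE ->.
  rewrite (bigD1 j)//= eqxx big1 ?addr0; last by move=> m /negbTE ->.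
  by rewrite subrr mulr0 addr0.
- under eq_bigr do rewrite scalerDl -scalerA.
  rewrite big_split/= lx -scaler_sumr /shiftrV; congr (_ + _ *: _).
  under eq_bigr do rewrite scalerBl; rewrite sumrB.
  rewrite (bigD1 i)//= eqxx scale1r big1 ?addr0; last by move=> m /negbTE ->; rewrite scale0r.
  by rewrite (bigD1 j)//= eqxx scale1r big1 ?addr0// => m /negbTE ->; rewrite scale0r.
Qed.

Lemma measurable_barycentric i : measurable_fun setT (l i).
Proof.
case: lK => /(_ i)[a [b lE]] _ _ _; rewrite (funext lE).
apply: measurable_funD => //; apply: measurable_sum => k.
by apply: measurable_funM => //; exact: measurable_coord.
Qed.

Lemma continuous_barycentric i : continuous (l i).
Proof.
case: lK => /(_ i)[a [b lE]] _ _ _; rewrite (funext lE) => x.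
have /(_ x) dx : continuous (fun y : 'rV[R]_d => \sum_i a 0 i * y 0 i).
  apply: (continuous_big (P := xpredT) (@add_continuous R)) => k _ y.
  apply: continuousM; first exact: cst_continuous.
  exact: coord_continuous.
apply: (continuousD dx); exact: cst_continuous.
Qed.

Lemma measurable_simplex : measurable (simplex node K).
Proof.
rewrite (_ : simplex node K = \bigcap_(i in [set: 'I_nv]) [set x | 0 <= l i x]).
  apply: fin_bigcap_measurable => // i _.
  by apply: measurable_set_ge; exact: measurable_barycentric.
by apply/seteqP; split => x; [move/simplexP => h i _|move=> h; apply/simplexP => i]; exact: h.
Qed.

Lemma barycentric_le1 x i : simplex node K x -> l i x <= 1.
Proof.
move/simplexP => h; case: lK => _ _ l1 _.
by rewrite -(l1 x) (bigD1 i)//= lerDl sumr_ge0.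
Qed.

Lemma simplex_sub_cube : exists r, 0 <= r /\ simplex node K `<=` cube r.
Proof.
exists (\sum_i `|node i|); split; first by rewrite sumr_ge0.
move=> x Sx k; case: (lK) => _ _ _ lx; rewrite -(lx x) summxE.
apply: (le_trans (ler_norm_sum _ _ _)); apply: ler_sum => i _.
rewrite mxE normrM; have /simplexP/(_ i) h := Sx.
rewrite ger0_norm// (@le_trans _ _ `|node i 0 k|)//.
  by rewrite ler_piMl// barycentric_le1.
exact: ler_coord_norm.
Qed.

Lemma simplex_finite : (lebesgue_rV d (simplex node K) < +oo)%E.
Proof.
have [r [r0 sr]] := simplex_sub_cube.
apply: le_lt_trans (lebesgue_rV_cube d r0).
by apply: le_measure => //; rewrite inE; [exact: measurable_simplex|exact: measurable_cube].
Qed.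

(* The translates of a face along an edge transversal to it are pairwise
   disjoint, have equal measure, and stay in a fixed cube. *)
Lemma face_null i j : i \in K -> j \in K -> i != j ->
  lebesgue_rV d (simplex node K `&` [set x | l j x = 0]) = 0%E.
Proof.
move=> iK jK ij; have [r [r0 sr]] := simplex_sub_cube.
pose e := node j - node i; pose r1 := r + `|e|.
set N := _ `&` _; pose Nt (t : R) := shiftrV (t *: e) @^-1` N.
have mN : measurable N.
  apply: measurableI; first exact: measurable_simplex.
  rewrite (_ : [set x | l j x = 0] = [set x | l j x <= 0] `&` [set x | 0 <= l j x]).
    apply: measurableI; [apply: measurable_set_le|apply: measurable_set_ge];
    exact: measurable_barycentric.
  by apply/seteqP; split => x /= => [->|[h1 h2]]//; apply/eqP; rewrite eq_le h1.
have mNt t : measurable (Nt t).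
  by rewrite -[X in measurable X]setTI; exact: measurable_shiftrV.
have NtE t x : Nt t x -> l j x = - t.
  move=> [_] /=; rewrite barycentric_shift// eqxx eq_sym (negbTE ij) subr0 mulr1 => h.
  by apply/eqP; rewrite -subr_eq0 opprK; apply/eqP.
have mNtE t : lebesgue_rV d (Nt t) = lebesgue_rV d N by exact: lebesgue_rV_shift.
have sub t : 0 <= t <= 1 -> Nt t `<=` cube r1.
  move=> /andP[t0 t1] x [/sr h _] k; have := h k; rewrite !mxE => h1.
  have ek : `|t * (node j 0 k - node i 0 k)| <= `|e|.
    rewrite normrM ger0_norm//.
    apply: (@le_trans _ _ (`|e 0 k|)); first by rewrite /e !mxE ler_piMl.
    exact: ler_coord_norm.
  rewrite -[x 0 k](addrK (t * (node j 0 k - node i 0 k))) /r1.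
  by apply: (le_trans (ler_normB _ _)); exact: lerD.
have bnd n : (\sum_(k < n) lebesgue_rV d N <= lebesgue_rV d (cube r1))%E.
  case: n => [|n]; first by rewrite big_ord0 measure_ge0.
  have n0 : (n.+1%:R : R) != 0 by rewrite pnatr_eq0.
  pose A (k : nat) := Nt (k%:R / n.+1%:R).
  rewrite (eq_bigr (fun k : 'I__ => lebesgue_rV d (A k))); last by move=> k _; rewrite mNtE.
  rewrite -measure_bigsetU//; last first.
  - apply/trivIsetP => k1 k2 _ _ k12; rewrite -subset0 => x [/NtE h1 /NtE h2].
    move: h2; rewrite h1 => /oppr_inj/(mulIf (invr_neq0 n0))/eqP.
    by rewrite eqr_nat; apply/negP.
  - by move=> k; exact: mNt.
  apply: le_measure; rewrite ?inE; [|exact: measurable_cube|].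
    by apply: bigsetU_measurable => k _; exact: mNt.
  rewrite -bigcup_seq => x [k _]; apply: sub.
  by rewrite divr_ge0//= ler_pdivrMr ?mul1r ?ler_nat ?ltr0n// ltnW.
have Cfin : lebesgue_rV d (cube r1) \is a fin_num.
  by rewrite ge0_fin_numE//; apply: lebesgue_rV_cube; rewrite addr_ge0.
have Nfin : lebesgue_rV d N \is a fin_num.
  rewrite ge0_fin_numE//; have := bnd 1%N; rewrite big_ord1 => /le_lt_trans; apply.
  by rewrite -ge0_fin_numE.
apply/eqP; rewrite eq_le measure_ge0 andbT leNgt; apply/negP => Npos.
move: bnd; rewrite -(fineK Cfin) -(fineK Nfin).
set v := fine _ in Npos *; set w := fine _ => bnd.
have v0 : 0 < v by rewrite -lte_fin /v fineK.
have := bnd (Num.truncn (w / v)).+1; rewrite sumEFin sumr_const card_ord lee_fin leNgt => /negP; apply.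
by rewrite -mulr_natr -ltr_pdivrMl// mulrC truncnS_gt.
Qed.

End barycentric.

(** * The mass matrix of a simplex *)

(** Integration by parts without boundary terms: every difference quotient of F integrates to 0 by
    translation invariance, and dominated convergence carries this over to the limit G. *)
Lemma integral_directional_derivative (R : realType) d (F G : 'rV[R]_d -> R)
    (e : 'rV[R]_d) (B : set 'rV[R]_d) (c : R) :
  measurable_fun setT F -> (forall x, 0 <= F x) ->
  (lebesgue_rV d).-integrable setT (EFin \o F) ->
  measurable_fun setT G -> measurable B -> (lebesgue_rV d B < +oo)%E ->
  (forall n x, `|n.+1%:R * (F (shiftrV (n.+1%:R^-1 *: e) x) - F x)| <= c * \1_B x) ->
  {ae lebesgue_rV d, forall x,
    (n.+1%:R * (F (shiftrV (n.+1%:R^-1 *: e) x) - F x)) @[n --> \oo] --> G x} ->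
  (lebesgue_rV d).-integrable setT (EFin \o G) /\
  (\int[lebesgue_rV d]_x (G x)%:E = 0)%E.
Proof.
move=> mF F0 iF mG mB Bfin bnd cvF.
pose f n x := n.+1%:R * (F (shiftrV (n.+1%:R^-1 *: e) x) - F x).
have mFs v : measurable_fun setT (fun x => F (shiftrV v x)).
  by apply: (measurableT_comp mF); exact: measurable_shiftrV.
have mf n : measurable_fun setT (f n).
  by apply: measurable_funM => //; exact: measurable_funB.
have IFs v : (\int[lebesgue_rV d]_x (F (shiftrV v x))%:E = \int[lebesgue_rV d]_x (F x)%:E)%E.
  rewrite (ge0_integral_rV_shift v (f := EFin \o F))//; exact/measurable_EFinP.
have iFs v : (lebesgue_rV d).-integrable setT (fun x => (F (shiftrV v x))%:E).
  apply/integrableP; split; first exact/measurable_EFinP.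
  under eq_integral do rewrite gee0_abs ?lee_fin//.
  rewrite IFs; move/integrableP : iF => [_].
  by under eq_integral do rewrite /= ger0_norm//.
have If0 n : (\int[lebesgue_rV d]_x (f n x)%:E = 0)%E.
  under eq_integral do rewrite EFinM EFinB.
  rewrite integralZl//; last exact: integrableB.
  rewrite integralB_EFin//=; last exact: iFs.
  rewrite IFs subee ?mule0//.
  exact: integrable_fin_num.
have [] := @dominated_convergence _ _ _ (lebesgue_rV d) setT measurableT
   (fun n => EFin \o f n) (EFin \o G) (fun x => (c * \1_B x)%:E).
- by move=> n; exact/measurable_EFinP.
- exact/measurable_EFinP.
- apply: filterS cvF => x h _; by apply: cvg_EFin => //; exact: nearW.
- have : (lebesgue_rV d).-integrable B (EFin \o cst c).
    apply: measurable_bounded_integrable => //.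
    exact: (@bounded_cst _ R^o).
  move/(integrable_mkcond _ mB); apply: eq_integrable => // x _.
  rewrite patchE indicE; case: ifP => _; rewrite ?mulr1 ?mulr0//.
- by apply: aeW => x n _; rewrite lee_fin; exact: bnd.
move=> iG _ cG; split => //.
move: cG; rewrite (_ : mk_sequence _ = cst 0%E); last by apply/funext => n; exact: If0.
by move/(cvg_lim (@ereal_hausdorff R)) <-; rewrite lim_cst.
Qed.

Section mass.
Context {R : realType} {d nv : nat} (node : 'I_nv -> 'rV[R]_d) (K : {set 'I_nv}).
Hypothesis indep : affinely_independent node K.
Variable l : 'I_nv -> 'rV[R]_d -> R.
Hypothesis lK : barycentric node K l.
Local Notation S := (simplex node K).
Local Notation mu := (lebesgue_rV d).

Lemma integrable_simplex (f : 'rV[R]_d -> R) (c : R) : measurable_fun setT f ->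
  (forall x, S x -> `|f x| <= c) -> mu.-integrable S (EFin \o f).
Proof.
move=> mf fc; apply: measurable_bounded_integrable.
- exact: measurable_simplex lK.
- exact: simplex_finite lK.
- exact: measurable_funTS.
- exists c; split; first exact: num_real.
  by move=> M cM x Sx; exact: (le_trans (fc _ Sx) (ltW cM)).
Qed.

(* l_i^2 l_j vanishes on the two faces crossed by the edge direction
   node i - node j, along which its derivative is 2 l_i l_j - l_i^2. *)
Lemma mass_diag i j : i \in K -> j \in K -> i != j ->
  \int[mu]_(x in S) (l i x * l i x) = 2 * \int[mu]_(x in S) (l i x * l j x).
Proof.
move=> iK jK ij.
have [r [r0 sr]] := simplex_sub_cube indep lK.
have mS := measurable_simplex indep lK.
have ml k := measurable_barycentric lK k.
have l01 k x : S x -> 0 <= l k x <= 1.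
  move=> Sx; rewrite (barycentric_le1 indep lK)// andbT.
  by move/(simplexP indep lK): Sx; exact.
pose F x := (l i x ^+ 2 * l j x) * \1_S x.
pose G x := (2 * (l i x * l j x) - l i x * l i x) * \1_S x.
pose e := node i - node j; pose r1 := r + `|e|.
have mF : measurable_fun setT F.
  by apply: measurable_funM => //; apply: measurable_funM => //; exact: measurable_funX.
have mG : measurable_fun setT G.
  apply: measurable_funM => //; apply: measurable_funB; last exact: measurable_funM.
  by apply: measurable_funM => //; exact: measurable_funM.
have F0 x : 0 <= F x.
  rewrite /F indicE; case: (boolP (x \in S)) => [|_]; rewrite ?mulr0// inE => Sx.
  by rewrite mulr1 mulr_ge0 ?sqr_ge0//; case/andP: (l01 j x Sx).
have restr (f : 'rV[R]_d -> R) : EFin \o (fun x => f x * \1_S x) = (EFin \o f) \_ S.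
  by apply/funext => x; rewrite patchE /= indicE; case: ifP => _; rewrite ?mulr1 ?mulr0.
have iS a b : mu.-integrable S (EFin \o (fun x => l a x * l b x)).
  apply: (@integrable_simplex _ 1); first exact: measurable_funM.
  move=> x Sx; rewrite normrM; have /andP[a0 a1] := l01 a x Sx.
  by have /andP[b0 b1] := l01 b x Sx; rewrite !ger0_norm// mulr_ile1.
have iF : mu.-integrable setT (EFin \o F).
  rewrite restr; apply/(integrable_mkcond _ mS).
  apply: (@integrable_simplex _ 1).
    by apply: measurable_funM => //; exact: measurable_funX.
  move=> x Sx; have /andP[a0 a1] := l01 i x Sx; have /andP[b0 b1] := l01 j x Sx.
  by rewrite ger0_norm ?mulr_ile1 ?mulr_ge0 ?sqr_ge0 ?exprn_ile1.
have li t x : l i (shiftrV (t *: e) x) = l i x + t.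
  by rewrite (barycentric_shift indep lK)// eqxx (negbTE ij) subr0 mulr1.
have lj t x : l j (shiftrV (t *: e) x) = l j x - t.
  by rewrite (barycentric_shift indep lK)// eqxx eq_sym (negbTE ij) sub0r mulrN1.
have lk k t x : k != i -> k != j -> l k (shiftrV (t *: e) x) = l k x.
  by move=> /negbTE ki /negbTE kj; rewrite (barycentric_shift indep lK)// ki kj subrr mulr0 addr0.
have t01 n : 0 < (n.+1%:R^-1 : R) <= 1.
  by rewrite invr_gt0 ltr0n/= invf_le1 ?ltr0n// ler1n.
have nt n : n.+1%:R * (n.+1%:R^-1 : R) = 1 by rewrite divff// pnatr_eq0.
have Sr x : S x -> cube r1 x.
  by move=> /sr h k; rewrite /r1 (le_trans (h k))// lerDl.
have Ssr n x : S (shiftrV (n.+1%:R^-1 *: e) x) -> cube r1 x.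
  move=> /sr h k; have := h k; rewrite !mxE => h1.
  have /andP[t0 t1] := t01 n.
  have ek : `|n.+1%:R^-1 * (node i 0 k - node j 0 k)| <= `|e|.
    rewrite normrM ger0_norm ?(ltW t0)//.
    apply: (@le_trans _ _ (`|e 0 k|)); first by rewrite /e !mxE ler_piMl.
    exact: ler_coord_norm.
  rewrite -[x 0 k](addrK (n.+1%:R^-1 * (node i 0 k - node j 0 k))) /r1.
  by apply: (le_trans (ler_normB _ _)); exact: lerD.
have [iG IG] : mu.-integrable setT (EFin \o G) /\ (\int[mu]_x (G x)%:E = 0)%E.
  (* 7 = 1 + 2 + 2 + 1 + 1 bounds the five terms of the expanded quotient when both points lie in S;
     the enlarged cube contains S and its translates by the steps used. *)
  apply: (@integral_directional_derivative _ _ F G e (cube r1) 7) => //.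
  - exact: measurable_cube.
  - by apply: lebesgue_rV_cube; rewrite addr_ge0.
  - move=> n x; have /andP[] := t01 n; have := nt n.
    have := Ssr n x; have := li n.+1%:R^-1 x; have := lj n.+1%:R^-1 x.
    have := fun k => lk k n.+1%:R^-1 x.
    rewrite /F; move: (n.+1%:R : R) (n.+1%:R^-1) => s t; move: (shiftrV _ x) => y.
    move=> lky ljy liy Sy st t0 t1.
    have s0 : 0 <= s by rewrite -(pmulr_lge0 _ t0) st.
    rewrite !indicE ljy liy.
    have [xS|xS] := pselect (S x); have [yS|yS] := pselect (S y).
    + rewrite !mem_set ?mulr1//; last exact: Sr.
      rewrite (_ : s * _ = (s * t) * (- l i x ^+ 2 + 2 * l i x * l j x - 2 * l i x * t
        + t * l j x - t ^+ 2)); last by ring.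
      have /andP[a0 a1] := l01 i x xS; have /andP[b0 b1] := l01 j x xS.
      have := mulr_ge0 a0 b0; have := mulr_ge0 a0 (ltW t0); have := mulr_ge0 (ltW t0) b0.
      have : l i x * l j x <= 1 by rewrite mulr_ile1.
      have : l i x * t <= 1 by rewrite mulr_ile1// ltW.
      have : t * l j x <= 1 by rewrite mulr_ile1// ltW.
      have : t ^+ 2 <= 1 by rewrite exprn_ile1// ltW.
      have : l i x ^+ 2 <= 1 by rewrite exprn_ile1.
      have := sqr_ge0 t; have := sqr_ge0 (l i x).
      by rewrite st mul1r ler_norml => *; apply/andP; split; lra.
    + rewrite (mem_set xS) (mem_set (Sr _ xS)) memNset// !mulr1 mulr0 sub0r mulrN normrN.
      have /andP[a0 a1] := l01 i x xS; have /andP[b0 b1] := l01 j x xS.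
      (* Only coordinate j decreases along the step, so S can be left only through the face l_j = 0;
         this gives F x <= t. *)
      have bt : l j x < t.
        rewrite ltNge; apply/negP => tb; apply: yS; apply/(simplexP indep lK) => k.
        have [->|ki] := eqVneq k i; first by rewrite liy addr_ge0// ltW.
        have [->|kj] := eqVneq k j; first by rewrite ljy subr_ge0.
        by rewrite lky//; case/andP: (l01 k x xS).
      rewrite ger0_norm ?mulr_ge0 ?sqr_ge0//.
      apply: (@le_trans _ _ (s * t)); last by rewrite st; lra.
      apply: ler_wpM2l => //; rewrite -[leRHS]mul1r; apply: ler_pM; rewrite ?sqr_ge0//.
        by rewrite exprn_ile1.
      exact: ltW.
    + rewrite (mem_set yS) (mem_set (Sy yS)) (memNset xS) !mulr1 mulr0 subr0.
      have /andP[a0 a1] := l01 i y yS; have /andP[b0 b1] := l01 j y yS.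
      rewrite liy in a0 a1; rewrite ljy in b0 b1.
      (* Only coordinate i increases along the step, so S can be entered only through the face l_i =
         0; then l_i < t at the new point, which bounds F there by t. *)
      have at0 : l i x < 0.
        rewrite ltNge; apply/negP => tb; apply: xS; apply/(simplexP indep lK) => k.
        have [->//|ki] := eqVneq k i.
        have [->|kj] := eqVneq k j; first by lra.
        by rewrite -lky//; case/andP: (l01 k y yS).
      rewrite ger0_norm ?mulr_ge0 ?sqr_ge0//.
      apply: (@le_trans _ _ (s * t)); last by rewrite st; lra.
      apply: ler_wpM2l => //; rewrite -[leRHS]mulr1; apply: ler_pM; rewrite ?sqr_ge0//.
      apply: (@le_trans _ _ (l i x + t)); last by lra.
      by rewrite expr2 ler_piMl.
    + by rewrite (memNset xS) (memNset yS) !mulr0 subrr mulr0 normr0 mulr_ge0.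
  (* On the face l_j = 0 the shifted points leave S at once and the quotient need not tend to G.
     Elsewhere in S they stay in S for large n, and off S some coordinate stays negative. *)
  - exists (S `&` [set x | l j x = 0]); split.
    + apply: measurableI => //.
      rewrite (_ : [set x | l j x = 0] = [set x | l j x <= 0] `&` [set x | 0 <= l j x]).
        by apply: measurableI; [apply: measurable_set_le|apply: measurable_set_ge].
      by apply/seteqP; split => x /= => [->|[h1 h2]]//; apply/eqP; rewrite eq_le h1.
    + exact: face_null lK _ _ iK jK ij.
    + move=> x; apply: contra_notP => xN /=.
      have t_lt (c : R) : 0 < c -> \forall n \near \oo, n.+1%:R^-1 < c.
        move=> c0; exact: (cvgr_lt 0 (@cvg_harmonic R) c c0).
      have [xS|xS] := pselect (S x).
        have /andP[a0 a1] := l01 i x xS.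
        have b0 : 0 < l j x.
          rewrite lt_neqAle; case/andP: (l01 j x xS) => -> _; rewrite andbT.
          by apply/eqP => b0; apply: xN; split => //=.
        have cv : (G x + (l j x - 2 * l i x) * harmonic n - harmonic n * harmonic n) @[n --> \oo] --> G x.
          rewrite [X in _ --> X](_ : _ = G x + (l j x - 2 * l i x) * 0 - 0 * 0); last first.
            by rewrite !mulr0 addr0 subr0.
          apply: cvgB; last by apply: cvgM; exact: cvg_harmonic.
          apply: cvgD; first exact: cvg_cst.
          by apply: cvgM; [exact: cvg_cst|exact: cvg_harmonic].
        apply: cvg_trans cv; apply: near_eq_cvg; near=> n.
        have tb : n.+1%:R^-1 < l j x by near: n; exact: t_lt.
        have /andP[t0 _] := t01 n.
        have yS : S (shiftrV (n.+1%:R^-1 *: e) x).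
          apply/(simplexP indep lK) => k.
          have [->|ki] := eqVneq k i; first by rewrite li addr_ge0// ltW.
          have [->|kj] := eqVneq k j; first by rewrite lj subr_ge0 ltW.
          by rewrite lk//; case/andP: (l01 k x xS).
        rewrite /F /G !indicE !mem_set// li lj /harmonic/= !mulr1.
        move: (nt n); move: (n.+1%:R : R) (n.+1%:R^-1) => s t st.
        rewrite [RHS](_ : _ = (s * t) * (- l i x ^+ 2 + 2 * l i x * l j x - 2 * l i x * t
          + t * l j x - t ^+ 2)); last by ring.
        by rewrite st; ring.
      rewrite /F /G !indicE (memNset xS) !mulr0.
      have [k lk0] : exists k, l k x < 0.
        apply: contrapT => h; apply: xS; apply/(simplexP indep lK) => k.
        by rewrite leNgt; apply/negP => hk; apply: h; exists k.
      apply: cvg_near_cst; near=> n.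
      have tb : n.+1%:R^-1 < - l k x by near: n; apply: t_lt; rewrite oppr_gt0.
      have /andP[t0 _] := t01 n.
      rewrite indicE memNset ?mulr0 ?subrr ?mulr0// => /(simplexP indep lK)/(_ k).
      have [ki|ki] := eqVneq k i; first by rewrite ki li leNgt -ltrBrDl sub0r -ki tb.
      have [kj|kj] := eqVneq k j; first by rewrite kj lj leNgt subr_lt0 -kj (lt_trans lk0 t0).
      by rewrite lk// leNgt lk0.
have e1 : \int[mu]_(x in S) (2 * (l i x * l j x) - l i x * l i x) = 0.
  rewrite /Rintegral (_ : (\int[mu]_(x in S) _ = \int[mu]_x (G x)%:E)%E) ?IG//.
  by rewrite integral_mkcond -restr.
apply/esym/eqP; rewrite -subr_eq0 -RintegralZl// -RintegralB//.
- exact/eqP.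
- exact: (integrableZl mS 2 (iS i j)).
Unshelve. all: by end_near.
Qed.
End mass.

(** * Piecewise affine functions on a triangulation *)

Lemma dot_sumr (R : realType) d n (a : 'rV[R]_d) (c : 'I_n -> R) (F : 'I_n -> 'rV[R]_d) :
  dot a (\sum_i c i *: F i) = \sum_i c i * dot a (F i).
Proof.
rewrite /dot; under eq_bigr do rewrite summxE mulr_sumr.
rewrite exchange_big; apply: eq_bigr => i _ /=; rewrite mulr_sumr.
by apply: eq_bigr => k _; rewrite mxE mulrCA.
Qed.

Section triangulation.
Context {R : realType} {d : nat} {D : set 'rV[R]_d} (M : triangulation D).
Local Notation node := (@node _ _ _ M).
Local Notation S := (simplex node).
Local Notation mu := (lebesgue_rV d).

Lemma barycentric_cells : exists L : {set 'I_(nv M)} -> 'I_(nv M) -> 'rV[R]_d -> R,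
  forall K, K \in cells M -> barycentric node K (L K).
Proof.
have [L hL] := @choice _ _ (fun (K : {set 'I_(nv M)}) l =>
  K \in cells M -> barycentric node K l) (fun K =>
  match pselect (K \in cells M) with
  | left KM => let: ex_intro l hl := barycentric_exists (cells_nondegenerate KM) (cells_card KM)
               in ex_intro _ l (fun _ => hl)
  | right KM => ex_intro _ (fun=> cst 0) (fun h => False_ind _ (KM h))
  end).
by exists L.
Qed.

Variable L : {set 'I_(nv M)} -> 'I_(nv M) -> 'rV[R]_d -> R.
Hypothesis LP : forall K, K \in cells M -> barycentric node K (L K).

Lemma cell_barycentric_unique K x c : K \in cells M -> supported K c ->
  \sum_i c i = 1 -> \sum_i c i *: node i = x -> forall i, c i = L K i x.
Proof.
by move=> KM; apply: (barycentric_unique (cells_nondegenerate KM) (LP KM)).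
Qed.

(** Conformity puts a common point in the simplex on K :&: K'; its coordinates there are supported
    in both cells, so uniqueness in each cell identifies them. *)
Lemma cells_compatible K K' x : K \in cells M -> K' \in cells M -> S K x -> S K' x ->
  forall i, L K i x = L K' i x.
Proof.
move=> KM KM' Kx Kx' i.
have : S (K :&: K') x by rewrite -(cells_conforming KM KM').
move=> [c [cs c0 c1 /esym cx]].
rewrite -(cell_barycentric_unique KM _ c1 cx) -?(cell_barycentric_unique KM' _ c1 cx)//.
  by move=> k kK; apply: cs; rewrite inE (negbTE kK) andbF.
by move=> k kK; apply: cs; rewrite inE (negbTE kK).
Qed.

Lemma node_simplex K i : K \in cells M -> i \in K -> S K (node i).
Proof.
move=> KM iK; apply/(simplexP (cells_nondegenerate KM) (LP KM)) => k.
by rewrite (barycentric_node (cells_nondegenerate KM) (LP KM))// ler0n.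
Qed.

Lemma hat_function_exists i : exists phi, piecewise_P1 M phi /\
  forall j, phi (node j) = (i == j)%:R.
Proof.
(* Some cell containing x; by [cells_compatible] the choice does not affect the coordinate, and the
   default is reached only outside the closure of D. *)
pose cell x := xget (finset.set0 : {set 'I_(nv M)}) [set K | K \in cells M /\ S K x].
have cellP K x : K \in cells M -> S K x -> cell x \in cells M /\ S (cell x) x.
  by move=> KM Kx; apply: (xgetPex _ (P := [set K | K \in cells M /\ S K x])); exists K.
exists (fun x => L (cell x) i x); split.
  move=> K KM; case: (LP KM) => /(_ i)[a [b lE]] _ _ _; exists a, b => x Kx.
  by have [cM cx] := cellP _ _ KM Kx; rewrite -lE; exact: cells_compatible.
move=> j; have [K KM jK] := cells_cover_nodes j.
have jx := node_simplex KM jK; have [cM cx] := cellP _ _ KM jx.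
rewrite (cells_compatible cM KM cx jx).
by rewrite (barycentric_node (cells_nondegenerate KM) (LP KM)).
Qed.

Lemma piecewise_P1_barycentric v K x : piecewise_P1 M v -> K \in cells M -> S K x ->
  v x = \sum_i L K i x * v (node i).
Proof.
move=> vP KM Kx; have [a [b vE]] := vP K KM; case: (LP KM) => _ ls l1 lx.
rewrite vE// -{1}(lx x) dot_sumr -[b in LHS]mul1r -(l1 x) mulr_suml -big_split/=.
apply: eq_bigr => i _; have [iK|iK] := boolP (i \in K).
  by rewrite vE -?mulrDr//; exact: node_simplex.
by rewrite ls// !mul0r addr0.
Qed.

Lemma nodal_basis_spec i : piecewise_P1 M (nodal_basis i) /\
  forall j, nodal_basis i (node j) = (i == j)%:R.
Proof. exact: (getPex (hat_function_exists i)). Qed.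

Lemma nodal_basisE i K x : K \in cells M -> S K x -> nodal_basis i x = L K i x.
Proof.
move=> KM Kx; have [P1 nE] := nodal_basis_spec i.
rewrite (piecewise_P1_barycentric P1 KM Kx) (bigD1 i)//= nE eqxx mulr1.
by rewrite big1 ?addr0// => k /negbTE ki; rewrite nE eq_sym ki mulr0.
Qed.

Lemma piecewise_P1_interpolant v : piecewise_P1 M (interpolant M v).
Proof.
move=> K KM.
have aE (i : 'I_(nv M)) : exists ab : 'rV[R]_d * R, forall x, S K x -> nodal_basis i x = dot ab.1 x + ab.2.
  by have [P1 _] := nodal_basis_spec i; have [a [b h]] := P1 K KM; exists (a, b).
have [ab abE] := choice aE.
exists (\sum_i v (node i) *: (ab i).1), (\sum_i v (node i) * (ab i).2) => x Kx.
rewrite /interpolant /dot; under [in RHS]eq_bigr do rewrite summxE mulr_suml.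
rewrite exchange_big -big_split/=; apply: eq_bigr => i _.
rewrite abE// mulrDr; congr (_ + _); rewrite /dot mulr_sumr.
by apply: eq_bigr => k _; rewrite mxE mulrA.
Qed.

Lemma interpolantE v K x : K \in cells M -> S K x ->
  interpolant M v x = \sum_i L K i x * v (node i).
Proof.
by move=> KM Kx; apply: eq_bigr => i _; rewrite (nodal_basisE _ KM Kx) mulrC.
Qed.

Lemma piecewise_P1_nodal v x : piecewise_P1 M v -> closure D x ->
  v x = \sum_i v (node i) * nodal_basis i x.
Proof.
move=> vP; rewrite (cells_cover M) => -[K KM Kx].
rewrite (piecewise_P1_barycentric vP KM Kx).
by apply: eq_bigr => i _; rewrite (nodal_basisE _ KM Kx) mulrC.
Qed.

Lemma piecewise_P1_bounded v : piecewise_P1 M v ->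
  exists c, 0 <= c /\ forall x, closure D x -> `|v x| <= c.
Proof.
move=> vP; exists (\sum_i `|v (node i)|); split; first by rewrite sumr_ge0.
move=> x; rewrite (cells_cover M) => -[K KM Kx].
rewrite (piecewise_P1_barycentric vP KM Kx); apply: (le_trans (ler_norm_sum _ _ _)).
apply: ler_sum => i _; rewrite normrM ler_piMl//.
have l0 := (simplexP (cells_nondegenerate KM) (LP KM) x).1 Kx i.
by rewrite ger0_norm//; exact: (barycentric_le1 (cells_nondegenerate KM) (LP KM)).
Qed.

Lemma piecewise_P1_measurable v : measurable D -> piecewise_P1 M v -> measurable_fun D v.
Proof.
move=> mD vP _ B mB.
have mS K : K \in cells M -> measurable (S K).
  by move=> KM; exact: (measurable_simplex (cells_nondegenerate KM) (LP KM)).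
rewrite (_ : D `&` v @^-1` B = D `&` \bigcup_(K in [set` cells M])
   (S K `&` (fun x => \sum_i L K i x * v (node i)) @^-1` B)).
  apply: measurableI => //; apply: fin_bigcup_measurable; first exact: finite_finset.
  move=> K KM; apply: measurableI; first exact: mS.
  rewrite -[X in measurable X]setTI; apply: (measurable_sum _ (h := fun i x => L K i x * v (node i))) => //.
  move=> i; apply: measurable_funM => //; exact: (measurable_barycentric (LP KM)).
apply/seteqP; split => x /= [Dx].
  move=> vB; split => //; have := subset_closure Dx; rewrite (cells_cover M) => -[K KM Kx].
  by exists K => //; split => //=; rewrite -(piecewise_P1_barycentric vP KM Kx).
by move=> [K KM [Kx]] /=; rewrite -(piecewise_P1_barycentric vP KM Kx).
Qed.

End triangulation.

(** * The reaction term *)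

Lemma fin_bigcup_null d (T : measurableType d) (R : realType) (mu : {measure set T -> \bar R})
    (I : finType) (P : {set I}) (F : I -> set T) :
  (forall i, i \in P -> measurable (F i)) -> (forall i, i \in P -> mu (F i) = 0%E) ->
  mu (\bigcup_(i in [set` P]) F i) = 0%E.
Proof.
move=> mF F0; rewrite (_ : \bigcup_(i in _) _ = \big[setU/set0]_(i <- enum P) F i); last first.
  by rewrite -bigcup_seq; congr bigcup; apply/seteqP; split => i /=; rewrite mem_enum.
rewrite big_seq; set A := (X in mu X).
suff [_ //] : measurable A /\ mu A = 0%E.
rewrite /A; elim/big_ind: _ => [|X Y [mX X0] [mY Y0]|i]; first by rewrite measure0.
  split; first exact: measurableU.
  have XY0 : (mu X + mu Y <= 0)%E by rewrite X0 Y0 adde0.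
  by apply/eqP; rewrite eq_le measure_ge0 andbT; exact: (le_trans (measureU2 _ mX mY)).
by rewrite mem_enum => iP; split; [exact: mF|exact: F0].
Qed.

Lemma integrable_EFin_sum d (T : measurableType d) (R : realType)
    (mu : {measure set T -> \bar R}) (A : set T) (I : Type) (s : seq I) (f : I -> T -> R) :
  measurable A -> (forall i, mu.-integrable A (EFin \o f i)) ->
  mu.-integrable A (EFin \o (fun x => \sum_(i <- s) f i x)).
Proof.
move=> mA fi; elim: s => [|i s IH].
  have -> : (fun x => \sum_(i <- [::]) f i x) = cst 0 by apply/funext => x; rewrite big_nil.
  exact: integrable0.
under eq_fun do rewrite big_cons; exact: (integrableD mA (fi i) IH).
Qed.

Lemma Rintegral_sum d (T : measurableType d) (R : realType) (mu : {measure set T -> \bar R})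
    (A : set T) (I : Type) (s : seq I) (f : I -> T -> R) : measurable A ->
  (forall i, mu.-integrable A (EFin \o f i)) ->
  \int[mu]_(x in A) (\sum_(i <- s) f i x) = \sum_(i <- s) \int[mu]_(x in A) f i x.
Proof.
move=> mA fi; elim: s => [|i s IH].
  have -> : (fun x => \sum_(i <- [::]) f i x) = cst 0 by apply/funext => x; rewrite big_nil.
  by rewrite big_nil Rintegral_cst// mul0r.
rewrite big_cons -IH -RintegralD//; last exact: integrable_EFin_sum.
by apply: eq_Rintegral => x _; rewrite big_cons.
Qed.

Section decomposition.
Context {R : realType} {d : nat} {D : set 'rV[R]_d} (M : triangulation D).
Local Notation node := (@node _ _ _ M).
Local Notation S := (simplex node).
Local Notation mu := (lebesgue_rV d).
Variable L : {set 'I_(nv M)} -> 'I_(nv M) -> 'rV[R]_d -> R.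
Hypothesis LP : forall K, K \in cells M -> barycentric node K (L K).
Hypothesis d0 : (0 < d)%N.
Hypothesis mD : measurable D.

Let face K i := S K `&` [set x | L K i x = 0].
(** Off this null set the closed cells are pairwise disjoint and contained in D, so D is their
    disjoint union up to measure zero. *)
Let N := \bigcup_(K in [set` cells M]) \bigcup_(i in [set` K]) face K i.

Let mS K : K \in cells M -> measurable (S K).
Proof. by move=> KM; exact: (measurable_simplex (cells_nondegenerate KM) (LP KM)). Qed.

Let mface K i : K \in cells M -> measurable (face K i).
Proof.
move=> KM; apply: measurableI; first exact: mS.
rewrite (_ : [set x | L K i x = 0] = [set x | L K i x <= 0] `&` [set x | 0 <= L K i x]).
  by apply: measurableI; [apply: measurable_set_le|apply: measurable_set_ge];
    exact: (measurable_barycentric (LP KM)).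
by apply/seteqP; split => x /= => [->|[h1 h2]]//; apply/eqP; rewrite eq_le h1.
Qed.

Let mN : measurable N.
Proof.
apply: fin_bigcup_measurable => [|K KM]; first exact: finite_finset.
by apply: fin_bigcup_measurable => [|i iK]; [exact: finite_finset|exact: mface].
Qed.

Let N0 : mu N = 0%E.
Proof.
apply: fin_bigcup_null => K KM.
  by apply: fin_bigcup_measurable => [|i iK]; [exact: finite_finset|exact: mface].
apply: fin_bigcup_null => i iK; first exact: mface.
(* As d > 0 the cell has a second vertex, and the edge to it is transversal to the face opposite to
   i. *)
have [j jK ji] : exists2 j, j \in K & j != i.
  have : (0 < #|K :\ i|)%N by have := cardsD1 i K; rewrite iK (cells_card KM) add1n => -[<-].
  by move=> /card_gt0P[j]; rewrite !inE => /andP[ji jK]; exists j.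
exact: (face_null (cells_nondegenerate KM) (LP KM) jK iK ji).
Qed.

(** Off the faces all coordinates in K are positive, which is an open condition, so x is interior to
    the cell and [cells_interior] applies. *)
Let cell_interior K x : K \in cells M -> (S K `\` N) x -> D x.
Proof.
move=> KM [Kx Nx]; apply: (cells_interior (t := M)).
have l0 := (simplexP (cells_nondegenerate KM) (LP KM) x).1 Kx.
have lpos i : i \in K -> 0 < L K i x.
  move=> iK; rewrite lt_neqAle l0 andbT; apply/eqP => li.
  by apply: Nx; exists K => //; exists i.
rewrite /interior; near=> y; exists K => //.
apply/(simplexP (cells_nondegenerate KM) (LP KM)).
near: y; apply: filter_forall => i; have [iK|iK] := boolP (i \in K).
  have cv := continuous_barycentric (LP KM) (i := i) (x := x).
  by apply: filterS (cvgr_gt _ cv _ (lpos i iK)) => y /ltW.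
by apply: nearW => y; case: (LP KM) => _ -> .
Unshelve. all: by end_near. Qed.

Lemma Rintegral_cells (h : 'rV[R]_d -> R) : mu.-integrable D (EFin \o h) ->
  (forall K, K \in cells M -> mu.-integrable (S K) (EFin \o h)) ->
  \int[mu]_(x in D) h x = \sum_(K in cells M) \int[mu]_(x in S K) h x.
Proof.
move=> ih ihS.
pose A K := if K \in cells M then S K `\` N else set0.
have mA K : measurable (A K).
  by rewrite /A; case: ifPn => // KM; apply: measurableD => //; exact: mS.
have DE : D `\` N = \big[setU/set0]_(K <- enum (cells M)) A K.
  rewrite -bigcup_seq; apply/seteqP; split => x.
    move=> [Dx Nx]; have := subset_closure Dx; rewrite (cells_cover M) => -[K /= KM Kx].
    by exists K; rewrite /= ?mem_enum// /A KM.
  move=> [K /=]; rewrite mem_enum /A => KM; rewrite KM => AKx; split; last by case: AKx.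
  exact: cell_interior AKx.
rewrite /Rintegral (negligible_integral mN mD ih N0) DE.
have uE : uniq (enum (cells M)) by exact: enum_uniq.
rewrite (integral_bigsetU_EFin _ mA uE)/=; first last.
- rewrite -DE; apply: (measurable_funS mD _ (measurable_int _ ih)); exact: subDsetl.
- apply/trivIsetP => K K' /=; rewrite !mem_enum => KM KM' KK'.
  rewrite -subset0 /A KM KM' => x [[Kx Nx] [K'x _]].
  (* Distinct cells have equally many vertices, so neither contains the other. At a common point the
     coordinate of such a vertex vanishes, which puts the point on a face. *)
  have [i iK iK'] : exists2 i, i \in K & i \notin K'.
    apply: contrapT => noti; move/negP: KK'; apply; apply/eqP/eqP.
    rewrite eqEcard (cells_card KM) (cells_card KM') leqnn andbT.
    apply/fintype.subsetP => i iK; apply: contrapT => /negP iK'; apply: noti; by exists i.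
  apply: Nx; exists K => //; exists i => //; split => //=.
  rewrite (cells_compatible LP KM KM' Kx K'x).
  by case: (LP KM') => _ ->.
rewrite big_enum/= -sum_fine; last first.
  move=> K KM; rewrite /A KM -negligible_integral//.
  - by apply: integrable_fin_num => //; [exact: mS|exact: ihS].
  - exact: mS.
  - exact: ihS.
apply: eq_bigr => K KM; rewrite /A KM -negligible_integral//.
- exact: mS.
- exact: ihS.
Qed.

End decomposition.

Section reaction.
Context {R : realType} {d : nat} {D : set 'rV[R]_d}.
Hypotheses (d0 : (0 < d)%N) (mD : measurable D) (Dfin : (lebesgue_rV d D < +oo)%E).
Local Notation mu := (lebesgue_rV d).

Lemma integrable_domain (f : 'rV[R]_d -> R) c : measurable_fun D f ->
  (forall x, D x -> `|f x| <= c) -> mu.-integrable D (EFin \o f).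
Proof.
move=> mf fc; apply: measurable_bounded_integrable => //.
exists c; split; first exact: num_real.
by move=> M cM x Dx; exact: (le_trans (fc _ Dx) (ltW cM)).
Qed.

(** On each cell the integral is alpha times the local form. Only 0 <= alpha <= |K| enters, which
    together with 0 <= C gives C |K|, whatever the shape of the cell. *)
Lemma interpolant_reaction_bound (f : R -> R) (C : R) : 0 <= C ->
  (forall (I : finType) (K : {set I}) (v : I -> R), #|K| = d.+1 ->
    \sum_(i in K) \sum_(j in K) (1 + (i == j)%:R) * (f (v i) * v j) <= C) ->
  forall (M : triangulation D) (v : 'rV[R]_d -> R), piecewise_P1 M v ->
  inner D (interpolant M (f \o v)) v <= C * fine (mu D).
Proof.
move=> C0 hC M v vP; have [L LP] := barycentric_cells M.
have mS K : K \in cells M -> measurable (simplex (node (t := M)) K).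
  by move=> KM; exact: (measurable_simplex (cells_nondegenerate KM) (LP K KM)).
have iLL K (KM : K \in cells M) i j :
    mu.-integrable (simplex (node (t := M)) K) (EFin \o (fun x => L K i x * L K j x)).
  apply: (integrable_simplex (cells_nondegenerate KM) (LP K KM) (c := 1)).
    by apply: measurable_funM => //; exact: (measurable_barycentric (LP K KM)).
  move=> x Sx; have l0 := (simplexP (cells_nondegenerate KM) (LP K KM) x).1 Sx.
  have l1 k := barycentric_le1 (cells_nondegenerate KM) (LP K KM) k Sx.
  by rewrite normrM !ger0_norm// mulr_ile1.
pose h x := interpolant M (f \o v) x * v x.
have hE K x : K \in cells M -> simplex (node (t := M)) K x -> h x =
    \sum_i \sum_j (f (v (node i)) * v (node j)) * (L K i x * L K j x).
  move=> KM Kx; rewrite /h (interpolantE LP _ KM Kx) (piecewise_P1_barycentric LP vP KM Kx).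
  rewrite mulr_suml; apply: eq_bigr => i _; rewrite mulr_sumr; apply: eq_bigr => j _ /=.
  ring.
have iP := piecewise_P1_interpolant LP (f \o v).
have ih : mu.-integrable D (EFin \o h).
  have [c1 [c10 hc1]] := piecewise_P1_bounded LP iP.
  have [c2 [c20 hc2]] := piecewise_P1_bounded LP vP.
  apply: (@integrable_domain _ (c1 * c2)).
    by apply: measurable_funM => //; exact: (piecewise_P1_measurable LP).
  by move=> x /subset_closure Dx; rewrite normrM ler_pM ?hc1 ?hc2.
have ihS K (KM : K \in cells M) : mu.-integrable (simplex (node (t := M)) K) (EFin \o h) /\
    \int[mu]_(x in simplex (node (t := M)) K) h x =
    \sum_i \sum_j (f (v (node i)) * v (node j)) *
       \int[mu]_(x in simplex (node (t := M)) K) (L K i x * L K j x).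
  have iijf i j : mu.-integrable (simplex (node (t := M)) K)
      (EFin \o (fun x => (f (v (node i)) * v (node j)) * (L K i x * L K j x))).
    exact: (integrableZl (mS K KM) _ (iLL K KM i j)).
  have isum i : mu.-integrable (simplex (node (t := M)) K)
      (EFin \o (fun x => \sum_j (f (v (node i)) * v (node j)) * (L K i x * L K j x))).
    by apply: integrable_EFin_sum => [|j]; [exact: mS|exact: iijf].
  split.
    apply: (@eq_integrable _ _ _ _ _ (mS K KM) (EFin \o (fun x =>
       \sum_i \sum_j (f (v (node i)) * v (node j)) * (L K i x * L K j x)))).
      by move=> x; rewrite inE => Kx; rewrite /= (hE K).
    by apply: integrable_EFin_sum => [|i]; [exact: mS|exact: isum].
  rewrite (@eq_Rintegral _ _ _ _ _ (fun x =>
       \sum_i \sum_j (f (v (node i)) * v (node j)) * (L K i x * L K j x))); last first.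
    by move=> x; rewrite inE => Kx; rewrite /= (hE K).
  rewrite Rintegral_sum//; last exact: mS.
  apply: eq_bigr => i _; rewrite Rintegral_sum//; last exact: mS.
  by apply: eq_bigr => j _; rewrite RintegralZl//; [exact: mS|exact: iLL].
have i1 K (KM : K \in cells M) : mu.-integrable (simplex (node (t := M)) K) (EFin \o cst (1 : R)).
  by apply: (integrable_simplex (cells_nondegenerate KM) (LP K KM) (c := 1)) => // x _ /=; rewrite normr1.
have cell K (KM : K \in cells M) : \int[mu]_(x in simplex (node (t := M)) K) h x <=
    C * \int[mu]_(x in simplex (node (t := M)) K) 1.
  have [_ ->] := ihS K KM.
  pose m i j := \int[mu]_(x in simplex (node (t := M)) K) (L K i x * L K j x).
  have mC i j : m i j = m j i by apply: eq_Rintegral => x _; rewrite mulrC.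
  have [i0 i0K] : exists i0, i0 \in K by apply/card_gt0P; rewrite (cells_card KM).
  have mdiag i j : i \in K -> j \in K -> i != j -> m i i = 2 * m i j.
    exact: (mass_diag (cells_nondegenerate KM) (LP K KM)).
  (* By symmetry m i i = 2 m i j = 2 m j i = m j j, so one number determines the whole mass
     matrix. *)
  have mii i : i \in K -> m i i = m i0 i0.
    move=> iK; have [->//|ii] := eqVneq i i0.
    by rewrite (mdiag i i0)// mC -(mdiag i0 i)// eq_sym.
  pose alpha := m i0 i0 / 2.
  have mE i j : i \in K -> j \in K -> m i j = (1 + (i == j)%:R) * alpha.
    move=> iK jK; have [->|ij] := eqVneq i j; first by rewrite mii// ?eqxx /alpha /=; field.
    by have := mdiag i j iK jK ij; rewrite mii// /alpha => ->; rewrite addr0 mul1r mulrAC mulfV ?mul1r// pnatr_eq0.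
  have m0 i j : i \notin K \/ j \notin K -> m i j = 0.
    move=> ij; rewrite /m (@eq_Rintegral _ _ _ _ _ (cst 0)) ?Rintegral_cst ?mul0r//; first exact: mS.
    by move=> x _; case: (LP K KM) => _ ls _ _ /=; case: ij => /ls ->; rewrite ?mulr0 ?mul0r.
  have alpha0 : 0 <= alpha.
    by rewrite divr_ge0// Rintegral_ge0// => x _; rewrite -expr2 sqr_ge0.
  have alpha1 : alpha <= \int[mu]_(x in simplex (node (t := M)) K) 1.
    apply: (@le_trans _ _ (m i0 i0)); first by move: alpha0; rewrite /alpha; lra.
    apply: le_Rintegral; [exact: mS|exact: iLL|exact: i1|].
    move=> x Sx; have l0 := (simplexP (cells_nondegenerate KM) (LP K KM) x).1 Sx.
    have l1 k := barycentric_le1 (cells_nondegenerate KM) (LP K KM) k Sx.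
    by rewrite mulr_ile1.
  rewrite (_ : \sum_i _ = alpha * \sum_(i in K) \sum_(j in K)
     (1 + (i == j)%:R) * (f (v (node i)) * v (node j))).
    apply: (@le_trans _ _ (alpha * C)); first by rewrite ler_wpM2l// (hC _ K (fun i => v (node i)))// (cells_card KM).
    by rewrite mulrC ler_wpM2l.
  rewrite (bigID (mem K)) /= [X in _ + X]big1 ?addr0; last first.
    by move=> i iK; rewrite big1// => j _; rewrite -/(m i j) m0 ?mulr0//; left.
  rewrite mulr_sumr; apply: eq_bigr => i iK.
  rewrite (bigID (mem K)) /= [X in _ + X]big1 ?addr0; last first.
    by move=> j jK; rewrite -/(m i j) m0 ?mulr0//; right.
  rewrite mulr_sumr; apply: eq_bigr => j jK.
  by rewrite -/(m i j) mE//; ring.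
have vol : fine (mu D) = \sum_(K in cells M) \int[mu]_(x in simplex (node (t := M)) K) 1.
  rewrite -(@Rintegral_cells _ _ _ _ L LP d0 mD (cst 1)) ?Rintegral_cst ?mul1r//.
  by apply: (@integrable_domain _ 1) => // x _ /=; rewrite normr1.
rewrite /inner -/h (@Rintegral_cells _ _ _ _ L LP d0 mD h ih); last first.
  by move=> K KM; case: (ihS K KM).
by rewrite vol mulr_sumr; apply: ler_sum => K KM; exact: cell.
Qed.

End reaction.

(** * Gaussian moments and independence *)

(** The Radon-Nikodym derivative of [normal_prob] and the explicit density have the same integral
    over every measurable set, hence agree almost everywhere. *)
Lemma ge0_integral_normal_prob (R : realType) (m s : R) (f : R -> \bar R) :
  measurable_fun setT f -> (forall x, 0 <= f x)%E ->
  (\int[normal_prob m s]_x f x =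
   \int[lebesgue_measure]_x (f x * (normal_pdf m s x)%:E))%E.
Proof.
move=> mf f0.
have dom := normal_prob_dominates m s.
rewrite -(Radon_Nikodym_SigmaFinite.change_of_variables dom f0 measurableT mf).
pose g := Radon_Nikodym_SigmaFinite.f (normal_prob m s) (@lebesgue_measure R).
have ig : lebesgue_measure.-integrable setT g := Radon_Nikodym_SigmaFinite.f_integrable dom.
have mg : measurable_fun setT g by exact: measurable_int ig.
have g0 x : (0 <= g x)%E by exact: Radon_Nikodym_SigmaFinite.f_ge0.
have mpdf : measurable_fun setT (fun x => (normal_pdf m s x)%:E : \bar R).
  by apply/measurable_EFinP; exact: measurable_normal_pdf.
apply: ge0_ae_eq_integral => //.
- by apply: emeasurable_funM.
- by apply: emeasurable_funM.
- by move=> x _; rewrite mule_ge0.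
- by move=> x _; rewrite mule_ge0// lee_fin normal_pdf_ge0.
apply: ae_eqe_mul2l; apply: integral_ae_eq => //.
by move=> A AE mA; rewrite -Radon_Nikodym_SigmaFinite.f_integral.
Qed.

(** This is y^n / n! <= exp y for y = (1 + z^2) / 4. The divisor 4 leaves the exponent z^2/4, half
    of the Gaussian exponent. *)
Lemma sqr_power_le_expR (R : realType) (n : nat) (z : R) :
  (1 + z ^+ 2) ^+ n <= 4 ^+ n * n`!%:R * expR 1 * expR (z ^+ 2 / 4).
Proof.
have y0 : 0 <= (1 + z ^+ 2) / 4 by rewrite divr_ge0 ?addr_ge0 ?sqr_ge0.
have h : ((1 + z ^+ 2) / 4) ^+ n / n`!%:R <= expR ((1 + z ^+ 2) / 4).
  case: n => [|n]; first by rewrite expr0 fact0 divr1 (le_trans _ (expR_ge1Dx _))// lerDl.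
  by apply: le_trans (expR_ge1Dxn n y0); rewrite lerDr.
have -> : (1 + z ^+ 2) ^+ n = 4 ^+ n * n`!%:R * (((1 + z ^+ 2) / 4) ^+ n / n`!%:R).
  rewrite expr_div_n; have f0 : n`!%:R != 0 :> R by rewrite pnatr_eq0 -lt0n fact_gt0.
  have p0 : (4 : R) ^+ n != 0 by rewrite expf_neq0.
  by move: f0 p0; move: (n`!%:R : R) (4 ^+ n : R) (_ ^+ n) => a b e a0 b0; field; rewrite a0 b0.
rewrite -!mulrA ler_wpM2l ?exprn_ge0// ler_wpM2l// (le_trans h)// -expRD ler_expR; lra.
Qed.

(** With x = s z the factor s^2 + x^2 yields s^2, the variance, and 1 + x^2 <= (1 + T) (1 + z^2)
    makes the rest uniform in s. *)
Lemma normal_moment_bound (R : realType) (n : nat) (T : R) : 0 < T ->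
  exists2 C : R, 0 <= C & forall s : R, 0 < s -> s ^+ 2 <= T ->
  (\int[normal_prob 0 s]_x ((s ^+ 2 + x ^+ 2) * (1 + x ^+ 2) ^+ n)%:E <= (C * s ^+ 2)%:E)%E.
Proof.
move=> T0; pose c : R := 4 ^+ n.+1 * n.+1`!%:R * expR 1.
have c0 : 0 <= c by rewrite !mulr_ge0 ?exprn_ge0 ?expR_ge0.
exists ((1 + T) ^+ n * c * Num.sqrt 2); first by rewrite !mulr_ge0 ?exprn_ge0// addr_ge0// ltW.
move=> s s0 sT; set C := _ * Num.sqrt 2.
have mf : measurable_fun setT (fun x : R => ((s ^+ 2 + x ^+ 2) * (1 + x ^+ 2) ^+ n)%:E).
  apply/measurable_EFinP; apply: measurable_funM; last apply: measurable_funX;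
  by apply: measurable_funD => //; exact: measurable_funX.
have f0 x : 0 <= (s ^+ 2 + x ^+ 2) * (1 + x ^+ 2) ^+ n :> R.
  by rewrite mulr_ge0 ?exprn_ge0 ?addr_ge0 ?sqr_ge0.
rewrite ge0_integral_normal_prob//.
(* The polynomial times the density of N(0, s) is dominated by the density of N(0, s'). *)
pose s' := Num.sqrt 2 * s.
have s'2 : s' ^+ 2 = 2 * s ^+ 2 by rewrite /s' exprMn sqr_sqrtr.
have s'0 : 0 < s' by rewrite mulr_gt0// sqrtr_gt0.
have -> : (C * s ^+ 2)%:E = (\int[lebesgue_measure]_x ((C * s ^+ 2) * normal_pdf 0 s' x)%:E)%E.
  under eq_integral do rewrite EFinM.
  by rewrite integralZl// ?integral_normal_pdf ?mule1//; exact: integrable_normal_pdf.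
have C0 : 0 <= C * s ^+ 2.
  by rewrite mulr_ge0 ?sqr_ge0// !mulr_ge0 ?exprn_ge0// addr_ge0// ltW.
apply: ge0_le_integral => //.
- by move=> x _; rewrite mule_ge0// lee_fin// normal_pdf_ge0.
- by apply: emeasurable_funM => //; apply/measurable_EFinP; exact: measurable_normal_pdf.
- by apply/measurable_EFinP; apply: measurable_funM => //; exact: measurable_normal_pdf.
move=> x _; rewrite -EFinM lee_fin !normal_pdfE ?gt_eqF//=.
have -> : normal_peak s = Num.sqrt 2 * normal_peak s'.
  rewrite /normal_peak.
  have -> : s' ^+ 2 * pi *+ 2 = 2 * (s ^+ 2 * pi *+ 2).
    by rewrite s'2 -mulrA mulrnAr.
  by rewrite sqrtrM// invfM mulrA mulfV ?mul1r// gt_eqF// sqrtr_gt0.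
pose z := x / s.
have xE : x = s * z by rewrite /z mulrC divfK// gt_eqF.
have -> : normal_fun 0 s x = expR (- (z ^+ 2 / 2)).
  by rewrite /normal_fun subr0 xE; congr expR; field; rewrite gt_eqF.
have -> : normal_fun 0 s' x = expR (- (z ^+ 2 / 4)).
  rewrite /normal_fun subr0 xE s'2; congr expR.
  by field; rewrite gt_eqF.
have pk : 0 <= normal_peak s' by exact: normal_peak_ge0.
have key : (s ^+ 2 + x ^+ 2) * (1 + x ^+ 2) ^+ n <= s ^+ 2 * (1 + T) ^+ n * (1 + z ^+ 2) ^+ n.+1.
  rewrite [leRHS](_ : _ = (s ^+ 2 * (1 + z ^+ 2)) * ((1 + T) ^+ n * (1 + z ^+ 2) ^+ n)); last by rewrite (exprS _ n); ring.
  rewrite (_ : s ^+ 2 + x ^+ 2 = s ^+ 2 * (1 + z ^+ 2)); last by rewrite xE; ring.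
  have z20 := sqr_ge0 z; have x20 := sqr_ge0 x.
  apply: ler_wpM2l; first by rewrite mulr_ge0 ?sqr_ge0// addr_ge0.
  rewrite -exprMn; apply: lerXn2r; rewrite ?nnegrE.
  - by rewrite addr_ge0.
  - by rewrite mulr_ge0// addr_ge0// ltW.
  rewrite xE exprMn; have := sqr_ge0 z; have := ler_wpM2r (sqr_ge0 z) sT.
  by have := ltW T0; have := mulr_ge0 (ltW T0) (sqr_ge0 z); nra.
have e : expR (- (z ^+ 2 / 2)) = expR (- (z ^+ 2 / 4)) * expR (- (z ^+ 2 / 4)).
  by rewrite -expRD; congr expR; lra.
rewrite e; set E := expR (- (z ^+ 2 / 4)).
have E0 : 0 <= E by exact: expR_ge0.
have key2 : (1 + z ^+ 2) ^+ n.+1 * E <= c.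
  rewrite /E expRN ler_pdivrMr ?expR_gt0//; exact: sqr_power_le_expR.
have P0 : 0 <= s ^+ 2 * (1 + T) ^+ n by rewrite mulr_ge0 ?sqr_ge0// exprn_ge0// addr_ge0// ltW.
apply: (@le_trans _ _ (s ^+ 2 * (1 + T) ^+ n * (1 + z ^+ 2) ^+ n.+1 * (Num.sqrt 2 * normal_peak s' * (E * E)))).
  by rewrite ler_wpM2r// !mulr_ge0.
rewrite [leLHS](_ : _ = (s ^+ 2 * (1 + T) ^+ n * Num.sqrt 2 * normal_peak s' * E) * ((1 + z ^+ 2) ^+ n.+1 * E)); last by ring.
rewrite [leRHS](_ : _ = (s ^+ 2 * (1 + T) ^+ n * Num.sqrt 2 * normal_peak s' * E) * c); last by rewrite /C; ring.
by apply: ler_wpM2l => //; do 3 apply: mulr_ge0 => //.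
Qed.

Lemma lebesgue_measureN (R : realType) (A : set R) : measurable A ->
  lebesgue_measure (-%R @^-1` A) = lebesgue_measure A.
Proof.
have mf : @measurable_fun _ _ (measurableTypeR R) (measurableTypeR R) setT -%R.
  exact: measurable_funN.
move=> mA; symmetry.
pose m : {measure set (measurableTypeR R) -> \bar R} :=
  measure_function_pushforward__canonical__measure_function_Measure lebesgue_measure mf.
apply: (@lebesgue_measure_unique R m) => // X [[u v] _ <-] /=.
have e : -%R @^-1` `]u, v] = `[- v, - u[%classic.
  by apply/seteqP; split => x /=; rewrite !in_itv/= lerNl ltrNr => /andP[-> ->].
rewrite /m /= /pushforward e !lebesgue_measure_itv/= !lte_fin ltrN2.
by case: ifP => // _; rewrite -!EFinB; congr (_%:E); ring.
Qed.

Lemma ge0_integral_normal_probN (R : realType) (s : R) (f : R -> \bar R) : s != 0 ->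
  measurable_fun setT f -> (forall x, 0 <= f x)%E ->
  (\int[normal_prob 0 s]_x f (- x)%R = \int[normal_prob 0 s]_x f x)%E.
Proof.
move=> s0 mf f0.
have mN : @measurable_fun _ _ (measurableTypeR R) (measurableTypeR R) setT -%R.
  exact: measurable_funN.
have mpdf : measurable_fun setT (fun x => (normal_pdf 0 s x)%:E : \bar R).
  by apply/measurable_EFinP; exact: measurable_normal_pdf.
have mg : measurable_fun setT (fun x => f x * (normal_pdf 0 s x)%:E)%E.
  exact: emeasurable_funM.
rewrite !ge0_integral_normal_prob//; last exact: (measurableT_comp mf mN).
have := @ge0_integral_pushforward _ _ _ _ R _ mN lebesgue_measure setT _ measurableT mg.
rewrite preimage_setT => h; transitivity
  (\int[lebesgue_measure]_x ((fun x => f x * (normal_pdf 0 s x)%:E)%E \o -%R) x)%E.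
  apply: eq_integral => x _ /=; rewrite !normal_pdfE//=.
  by rewrite /normal_fun !subr0 sqrrN.
rewrite -h; last by move=> x _; rewrite mule_ge0// lee_fin normal_pdf_ge0.
by apply: eq_measure_integral => A mA _; exact: lebesgue_measureN.
Qed.

Section independence.
Context {R : realType} {disp : measure_display} {Omega : measurableType disp}.
Variable P : probability Omega R.
Local Open Scope ereal_scope.

(** Independence identifies the joint law with the product of the two laws, and Tonelli separates
    the integral; nonnegativity allows infinite values. *)
Lemma expectation_indep_mul (X Y : Omega -> R) (h : R -> R) :
  measurable_fun setT X -> measurable_fun setT Y -> measurable_fun setT h ->
  (forall A B : set R, measurable A -> measurable B ->
     P (X @^-1` A `&` Y @^-1` B) = P (X @^-1` A) * P (Y @^-1` B)) ->
  (forall w, 0 <= X w)%R -> (forall y, 0 <= h y)%R ->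
  \int[P]_w (X w * h (Y w))%:E = \int[P]_w (X w)%:E * \int[P]_w (h (Y w))%:E.
Proof.
move=> mX mY mh indep X0 h0.
have mXY : measurable_fun setT (fun w => (X w, Y w)) by exact: measurable_fun_pair.
pose X' : {mfun Omega >-> R} := mfun_Sub (mem_set mX).
pose Y' : {mfun Omega >-> R} := mfun_Sub (mem_set mY).
(* The absolute value makes f nonnegative on the whole plane; on the range of X it changes
   nothing. *)
pose f (z : R * R) : \bar R := (`|z.1| * h z.2)%:E.
have mf : measurable_fun setT f.
  apply/measurable_EFinP; apply: measurable_funM; first exact: measurableT_comp.
  exact: measurableT_comp.
have f0 z : 0 <= f z by rewrite lee_fin mulr_ge0.
transitivity (\int[P]_w (f \o (fun w => (X w, Y w))) w).
  by apply: eq_integral => w _; rewrite /f /= ger0_norm.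
have := @ge0_integral_pushforward _ _ _ _ R _ mXY P setT f measurableT mf.
rewrite preimage_setT => <-; last by move=> z _; exact: f0.
pose m := measure_function_pushforward__canonical__measure_function_Measure P mXY.
transitivity (\int[distribution P X' \x distribution P Y']_z f z).
  apply: eq_measure_integral => A mA _; apply/esym.
  by apply: (@product_measure_unique _ _ _ _ _ (distribution P X') (distribution P Y') m).
rewrite fubini_tonelli1//.
have IX : \int[P]_w (X w)%:E = \int[distribution P X']_x `|x|%:E.
  rewrite ge0_integral_distribution//.
    by apply: eq_integral => w _; rewrite /= ger0_norm.
  by apply/measurable_EFinP; exact: normr_measurable.
have IY : \int[P]_w (h (Y w))%:E = \int[distribution P Y']_y (h y)%:E.
  rewrite ge0_integral_distribution//; exact/measurable_EFinP.
rewrite IX IY /fubini_F -ge0_integralZr//.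
- apply: eq_integral => x _; rewrite /f /=.
  under eq_integral do rewrite EFinM.
  rewrite ge0_integralZl//; first exact/measurable_EFinP.
  by move=> y _; rewrite lee_fin.
- by apply/measurable_EFinP; exact: normr_measurable.
- by apply: integral_ge0 => y _; rewrite lee_fin.
Qed.

End independence.

(** * One time step *)

Lemma power_taylor1 (R : realFieldType) (y : R) m :
  `|(1 + y) ^+ m - 1 - m%:R * y| <= m%:R ^+ 2 * y ^+ 2 * (1 + `|y|) ^+ m.
Proof.
have y1 : 1 <= 1 + `|y| by rewrite lerDl.
elim: m => [|m IH]; first by rewrite expr0 subrr mul0r subrr normr0 expr0n/= !mul0r.
have -> : (1 + y) ^+ m.+1 - 1 - m.+1%:R * y =
    (1 + y) * ((1 + y) ^+ m - 1 - m%:R * y) + m%:R * y ^+ 2.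
  by rewrite exprS -natr1; ring.
apply: (le_trans (ler_normD _ _)); rewrite normrM.
have h1 : `|1 + y| * `|(1 + y) ^+ m - 1 - m%:R * y| <=
    (1 + `|y|) * (m%:R ^+ 2 * y ^+ 2 * (1 + `|y|) ^+ m).
  by apply: ler_pM => //; apply: (le_trans (ler_normD _ _)); rewrite normr1.
have h2 : `|m%:R * y ^+ 2| <= m%:R * y ^+ 2 * (1 + `|y|) ^+ m.+1.
  have p0 : 0 <= m%:R * y ^+ 2 by rewrite mulr_ge0 ?sqr_ge0.
  by rewrite ger0_norm//; apply: ler_peMr => //; exact: exprn_ege1.
apply: (le_trans (lerD h1 h2)).
have z0 : 0 <= y ^+ 2 * (1 + `|y|) ^+ m.+1.
  by rewrite mulr_ge0 ?sqr_ge0 ?exprn_ge0// addr_ge0.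
rewrite [leLHS](_ : _ = (m%:R ^+ 2 + m%:R) * (y ^+ 2 * (1 + `|y|) ^+ m.+1)); last by rewrite (exprS _ m); ring.
rewrite -mulrA ler_wpM2r// -natr1; have : 0 <= m%:R :> R by []; nra.
Qed.

(** Only b x is kept exactly, since it cancels in expectation. The other terms carry the factor t +
    x^2, of Gaussian mean O(t): the drift directly, and the Taylor remainder because y^2 is bounded
    by a multiple of (t + x^2) (1 + x^2). That last factor accounts for the exponent m + 1. *)
Lemma power_step_bound (R : realFieldType) (K T : R) m : 0 <= K -> 0 <= T ->
  exists2 C : R, 0 <= C & forall t b x, 0 <= t <= T -> `|b| <= K ->
  (1 + (K * (t + x ^+ 2) + b * x)) ^+ m <=
    1 + m%:R * (b * x) + C * ((t + x ^+ 2) * (1 + x ^+ 2) ^+ m.+1).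
Proof.
move=> K0 T0; pose L := 1 + K * (T + 2).
have L0 : 0 <= L by rewrite addr_ge0// mulr_ge0// addr_ge0.
exists (m%:R * K + 2 * m%:R ^+ 2 * K ^+ 2 * (1 + T) * L ^+ m).
  by rewrite !(addr_ge0, mulr_ge0, exprn_ge0).
move=> t b x /andP[t0 tT] bK; set y := K * _ + _.
have x20 := sqr_ge0 x.
have nx : `|x| <= 1 + x ^+ 2.
  by rewrite -[x ^+ 2]real_normK ?num_real//; have := sqr_ge0 (`|x| - 1); have := normr_ge0 x; nra.
have ny : `|y| <= K * (t + x ^+ 2 + `|x|).
  apply: (le_trans (ler_normD _ _)); rewrite [leRHS]mulrDr lerD//.
    by rewrite ger0_norm// mulr_ge0// addr_ge0.
  by rewrite normrM ler_wpM2r.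
have y2 : y ^+ 2 <= 2 * K ^+ 2 * (1 + T) * ((t + x ^+ 2) * (1 + x ^+ 2)).
  have : y ^+ 2 <= (K * (t + x ^+ 2 + `|x|)) ^+ 2.
    by rewrite -[y ^+ 2]real_normK ?num_real// lerXn2r ?nnegrE// (le_trans _ ny).
  move=> /le_trans; apply.
  rewrite exprMn [leRHS](_ : _ = K ^+ 2 * (2 * ((1 + T) * ((t + x ^+ 2) * (1 + x ^+ 2))))); last by ring.
  apply: ler_wpM2l; first exact: sqr_ge0.
  have : (t + x ^+ 2 + `|x|) ^+ 2 <= 2 * ((t + x ^+ 2) ^+ 2 + x ^+ 2).
    rewrite -[in X in _ <= 2 * (_ + X)](@real_normK _ x) ?num_real//.
    have := sqr_ge0 (t + x ^+ 2 - `|x|); lra.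
  move=> /le_trans; apply; rewrite ler_wpM2l//.
  rewrite [leLHS](_ : _ = (t + x ^+ 2) * (t + x ^+ 2) + x ^+ 2 * 1); last by ring.
  have w0 : 0 <= t + x ^+ 2 by rewrite addr_ge0.
  apply: (@le_trans _ _ ((t + x ^+ 2) * (t + x ^+ 2 + 1))); first by
    rewrite [leRHS](_ : _ = (t + x ^+ 2) * (t + x ^+ 2) + (t + x ^+ 2) * 1) ?lerD2l ?mulr1 ?lerDr//; ring.
  rewrite mulrCA ler_wpM2l//; have := mulr_ge0 T0 x20; lra.
have y1 : 1 + `|y| <= L * (1 + x ^+ 2).
  rewrite /L mulrDl mul1r lerD ?lerDl//; apply: (le_trans ny); rewrite -mulrA ler_wpM2l//.
  have := mulr_ge0 T0 x20; lra.
have w0 : 0 <= t + x ^+ 2 by rewrite addr_ge0.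
have q1 : 1 <= 1 + x ^+ 2 by rewrite lerDl.
have h : m%:R ^+ 2 * y ^+ 2 * (1 + `|y|) ^+ m <=
    2 * m%:R ^+ 2 * K ^+ 2 * (1 + T) * L ^+ m * ((t + x ^+ 2) * (1 + x ^+ 2) ^+ m.+1).
  rewrite [leRHS](_ : _ = m%:R ^+ 2 * (2 * K ^+ 2 * (1 + T) * ((t + x ^+ 2) * (1 + x ^+ 2)))
    * (L * (1 + x ^+ 2)) ^+ m); last by rewrite exprMn (exprS _ m); ring.
  apply: ler_pM.
  - by rewrite mulr_ge0 ?sqr_ge0.
  - by rewrite exprn_ge0// addr_ge0.
  - by rewrite ler_wpM2l ?sqr_ge0.
  - by rewrite lerXn2r ?nnegrE ?addr_ge0// (le_trans _ y1) ?addr_ge0.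
have h' : m%:R * (K * (t + x ^+ 2)) <= m%:R * K * ((t + x ^+ 2) * (1 + x ^+ 2) ^+ m.+1).
  by rewrite mulrA ler_wpM2l ?mulr_ge0// ler_peMr// exprn_ege1.
have := le_trans (ler_norm _) (power_taylor1 y m).
set W := (t + x ^+ 2) * _ in h h' *; set Y := m%:R ^+ 2 * y ^+ 2 * _ in h *.
rewrite [(_ + _) * W]mulrDl.
have -> : m%:R * y = m%:R * (K * (t + x ^+ 2)) + m%:R * (b * x) by rewrite /y mulrDr.
move: h h'; move: ((1 + y) ^+ m) Y W => B Y W h h' h''.
have := lerD (lerD h'' h) h'; lra.
Qed.

Section moment_step.
Context {R : realType} {disp : measure_display} {Omega : measurableType disp}.
Variable P : probability Omega R.

Lemma measurable_wrt_fun (G : set (set Omega)) (X : Omega -> R) :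
  G `<=` measurable -> measurable_wrt G X -> measurable_fun setT X.
Proof. by move=> GM XG _ B mB; rewrite setTI; apply: GM; exact: XG. Qed.

Lemma ge0_integral_gaussian (Y : Omega -> R) (s : R) (f : R -> \bar R) :
  measurable_fun setT Y ->
  (forall B : set R, measurable B -> P (Y @^-1` B) = normal_prob 0 s B) ->
  measurable_fun setT f -> (forall x, 0 <= f x)%E ->
  (\int[P]_w f (Y w) = \int[normal_prob 0 s]_x f x)%E.
Proof.
move=> mY YN mf f0.
have mY' : @measurable_fun _ _ Omega (measurableTypeR R) setT Y by exact: mY.
have := @ge0_integral_pushforward _ _ _ _ R _ mY' P setT f measurableT mf.
rewrite preimage_setT => <-; last by move=> z _; exact: f0.
by apply: eq_measure_integral => A mA _; exact: YN.
Qed.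

(** The constant is fixed before the step size and the processes. G is an arbitrary family of
    measurable sets, so measurability is required directly of X^m and X^m (b + K), the two
    nonnegative factors to be paired with functions of Y. *)
Definition moment_growth (m : nat) (K T C : R) : Prop :=
  forall (G : set (set Omega)) (X X' b Y : Omega -> R) (t : R),
  G `<=` measurable -> 0 < t <= T ->
  measurable_wrt G (fun w => X w ^+ m) ->
  measurable_wrt G (fun w => X w ^+ m * (b w + K)) ->
  measurable_fun setT X' -> measurable_fun setT Y ->
  (forall B : set R, measurable B -> P (Y @^-1` B) = normal_prob 0 (Num.sqrt t) B) ->
  (forall A (B : set R), G A -> measurable B ->
    P (A `&` Y @^-1` B) = (P A * P (Y @^-1` B))%E) ->
  (forall w, 0 <= X w) -> (forall w, 0 <= X' w) -> (forall w, `|b w| <= K) ->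
  {ae P, forall w, X' w <= X w * (1 + (K * (t + Y w ^+ 2) + b w * Y w))} ->
  (\int[P]_w (X w ^+ m)%:E < +oo)%E ->
  (\int[P]_w (X' w ^+ m)%:E <= (1 + C * t)%:E * \int[P]_w (X w ^+ m)%:E)%E.

Lemma moment_step (m : nat) (K T : R) : 0 <= K -> 0 < T ->
  exists2 C : R, 0 <= C & moment_growth m K T C.
Proof.
move=> K0 T0; have [C1 C10 hC1] := power_step_bound m K0 (ltW T0).
have [C2 C20 hC2] := normal_moment_bound m.+1 T0.
exists (C1 * C2); first exact: mulr_ge0.
move=> G X X' b Y t GM /andP[t0 tT] GU GV mX' mY YN indep X0 X'0 bK step EUfin.
(* The linear term X^m b Y is (V - K U) (p Y - n Y) with U, V, p, n >= 0; both
   sides are compared after moving the negative products across, and these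
   cancel in expectation since E (p Y) = E (n Y). *)
pose U w := X w ^+ m; pose V w := X w ^+ m * (b w + K).
have U0 w : 0 <= U w by exact: exprn_ge0.
have bK0 w : 0 <= b w + K by have := bK w; rewrite ler_norml => /andP[]; lra.
have V0 w : 0 <= V w by apply: mulr_ge0; [exact: U0|exact: bK0].
have VU w : V w <= 2 * K * U w.
  rewrite /V mulrC; apply: ler_wpM2r; first exact: U0.
  by have := ler_norm (b w); have := bK w; lra.
have mU := measurable_wrt_fun GM GU; have mV := measurable_wrt_fun GM GV.
have mXm : measurable_fun setT (fun w => X' w ^+ m) by exact: measurable_funX.
pose p (y : R) := Num.max y 0; pose n (y : R) := Num.max (- y) 0.
have p0 y : 0 <= p y by rewrite le_max lexx orbT.
have n0 y : 0 <= n y by rewrite le_max lexx orbT.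
have pn y : y = p y - n y.
  rewrite /p /n; have [y0|y0] := leP 0 y.
    by rewrite max_r ?oppr_le0// subr0.
  by rewrite max_l ?oppr_ge0 ?(ltW y0)// sub0r opprK.
have mp : measurable_fun setT p by exact: measurable_maxr.
have mn : measurable_fun setT n by apply: measurable_maxr => //; exact: measurable_funN.
pose r (y : R) := C1 * ((t + y ^+ 2) * (1 + y ^+ 2) ^+ m.+1).
have r0 y : 0 <= r y by rewrite mulr_ge0// mulr_ge0 ?exprn_ge0// addr_ge0 ?sqr_ge0// ltW.
have mr : measurable_fun setT r.
  apply: measurable_funM => //; apply: measurable_funM; last apply: measurable_funX;
  by apply: measurable_funD => //; exact: measurable_funX.
have s0 : Num.sqrt t != 0 :> R by rewrite gt_eqF// sqrtr_gt0.
have st : Num.sqrt t ^+ 2 = t :> R by rewrite sqr_sqrtr// ltW.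
have indepX (Z : Omega -> R) : measurable_wrt G Z -> forall A B : set R, measurable A -> measurable B ->
    P (Z @^-1` A `&` Y @^-1` B) = (P (Z @^-1` A) * P (Y @^-1` B))%E.
  by move=> GZ A B mA mB; apply: indep => //; exact: GZ.
have Emul (Z : Omega -> R) (h : R -> R) : measurable_wrt G Z -> measurable_fun setT h ->
    (forall w, 0 <= Z w) -> (forall y, 0 <= h y) ->
    (\int[P]_w (Z w * h (Y w))%:E = \int[P]_w (Z w)%:E * \int[P]_w (h (Y w))%:E)%E.
  move=> GZ mh Z0 h0; apply: expectation_indep_mul => //.
    exact: measurable_wrt_fun GZ.
  exact: indepX.
have Er : (\int[P]_w (r (Y w))%:E <= (C1 * C2 * t)%:E)%E.
  rewrite (ge0_integral_gaussian mY YN (f := EFin \o r)); last 2 first.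
  - exact/measurable_EFinP.
  - by move=> x; rewrite lee_fin.
  under eq_integral do rewrite /= EFinM.
  rewrite ge0_integralZl//; last 2 first.
  - apply/measurable_EFinP; apply: measurable_funM; last apply: measurable_funX;
    by apply: measurable_funD => //; exact: measurable_funX.
  - by move=> x _; rewrite lee_fin mulr_ge0 ?exprn_ge0// addr_ge0 ?sqr_ge0// ltW.
  rewrite -mulrA EFinM; apply: lee_wpmul2l => //.
  have := hC2 (Num.sqrt t); rewrite sqrtr_gt0 st; apply => //.
have Epn : (\int[P]_w (n (Y w))%:E = \int[P]_w (p (Y w))%:E)%E.
  rewrite (ge0_integral_gaussian mY YN (f := EFin \o n)); last 2 first.
  - exact/measurable_EFinP.
  - by move=> x; rewrite lee_fin.
  rewrite (ge0_integral_gaussian mY YN (f := EFin \o p)); last 2 first.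
  - exact/measurable_EFinP.
  - by move=> x; rewrite lee_fin.
  apply: (@ge0_integral_normal_probN _ _ (EFin \o p) s0); first exact/measurable_EFinP.
  by move=> x; rewrite lee_fin.
have Epfin : (\int[P]_w (p (Y w))%:E < +oo)%E.
  rewrite (ge0_integral_gaussian mY YN (f := EFin \o p)); last 2 first.
  - exact/measurable_EFinP.
  - by move=> x; rewrite lee_fin.
  (* Finiteness of E p(Y) follows from t p(x) <= (t + x^2) (1 + x^2) after dividing by t > 0. *)
  have [C3 C30 hC3] := normal_moment_bound 1 T0.
  have := hC3 (Num.sqrt t); rewrite sqrtr_gt0 st => /(_ t0 tT) h3.
  have : (\int[normal_prob 0 (Num.sqrt t)]_x (t * p x)%:E <= (C3 * t)%:E)%E.
    apply: le_trans h3; apply: ge0_le_integral => //.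
    - by move=> x _; rewrite lee_fin mulr_ge0// ltW.
    - by apply/measurable_EFinP; apply: measurable_funM.
    - by apply/measurable_EFinP; apply: measurable_funM; [|apply: measurable_funX];
        apply: measurable_funD => //; exact: measurable_funX.
    move=> x _; rewrite lee_fin expr1; have x20 := sqr_ge0 x.
    apply: ler_pM => //; rewrite ?(ltW t0) ?lerDl//.
    by rewrite /p ge_max addr_ge0// andbT; have := sqr_ge0 (x - 1); nra.
  under eq_integral do rewrite EFinM.
  rewrite ge0_integralZl//; last 3 first.
  - exact/measurable_EFinP.
  - by move=> x _; rewrite lee_fin.
  - by rewrite lee_fin ltW.
  move=> h; rewrite ltey; apply/eqP => Eoo; move: h.
  by rewrite Eoo gt0_muley ?lte_fin.
have mUY (h : R -> R) (Z : Omega -> R) : measurable_fun setT Z -> measurable_fun setT h ->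
    measurable_fun setT (fun w => (Z w * h (Y w))%:E).
  move=> mZ mh; apply/measurable_EFinP; apply: measurable_funM => //.
  exact: measurableT_comp.
have EVfin : (\int[P]_w (V w)%:E < +oo)%E.
  apply: (@le_lt_trans _ _ ((2 * K)%:E * \int[P]_w (U w)%:E)%E); last first.
    by apply: lte_mul_pinfty => //; rewrite lee_fin mulr_ge0.
  rewrite -ge0_integralZl//; last 3 first.
  - exact/measurable_EFinP.
  - by move=> w _; rewrite lee_fin.
  - by rewrite lee_fin mulr_ge0.
  apply: ge0_le_integral => //.
  - by move=> w _; rewrite lee_fin.
  - exact/measurable_EFinP.
  - by apply/measurable_EFinP; exact: measurable_funM.
  by move=> w _; rewrite -EFinM lee_fin.
have Ea a : 0 <= a -> (\int[P]_w (a * n (Y w))%:E = \int[P]_w (a * p (Y w))%:E)%E /\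
    (\int[P]_w (a * p (Y w))%:E < +oo)%E.
  move=> a0; have mpY : measurable_fun setT (fun w => (p (Y w))%:E).
    by apply/measurable_EFinP; exact: measurableT_comp.
  have mnY : measurable_fun setT (fun w => (n (Y w))%:E).
    by apply/measurable_EFinP; exact: measurableT_comp.
  have Zl (h : R -> R) : (forall y, 0 <= h y) -> measurable_fun setT (fun w => (h (Y w))%:E) ->
      (\int[P]_w (a * h (Y w))%:E = a%:E * \int[P]_w (h (Y w))%:E)%E.
    move=> h0 mh; under eq_integral do rewrite EFinM.
    by rewrite ge0_integralZl// => w _; rewrite lee_fin.
  by rewrite !Zl// Epn; split => //; exact: lte_mul_pinfty.
have mK0 : 0 <= m%:R * K by rewrite mulr_ge0.
have [E1 F1] := Ea m%:R (ler0n _ _); have [E2 F2] := Ea (m%:R * K) mK0.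
have ma a (h : R -> R) : measurable_fun setT h -> measurable_fun setT (fun y => a * h y).
  by move=> mh; exact: measurable_funM.
have a0 a (h : R -> R) : 0 <= a -> (forall y, 0 <= h y) -> forall y, 0 <= a * h y.
  by move=> ? h0 y; rewrite mulr_ge0.
pose Lf w := ((X' w ^+ m)%:E + ((V w * (m%:R * n (Y w)))%:E + (U w * (m%:R * K * p (Y w)))%:E))%E.
pose Rf w := (((U w)%:E + (U w * r (Y w))%:E) + ((V w * (m%:R * p (Y w)))%:E + (U w * (m%:R * K * n (Y w)))%:E))%E.
have mVn := mUY _ _ mV (ma m%:R _ mn); have mVp := mUY _ _ mV (ma m%:R _ mp).
have mUn := mUY _ _ mU (ma (m%:R * K) _ mn); have mUp := mUY _ _ mU (ma (m%:R * K) _ mp).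
have mUr := mUY _ _ mU mr.
have mUE : measurable_fun setT (fun w => (U w)%:E) by exact/measurable_EFinP.
have Vh_ge0 (h : R -> R) w : (forall y, 0 <= h y) -> (0 <= (V w * h (Y w))%:E)%E.
  by move=> h0; rewrite lee_fin; apply: mulr_ge0; [exact: V0|exact: h0].
have Uh_ge0 (h : R -> R) w : (forall y, 0 <= h y) -> (0 <= (U w * h (Y w))%:E)%E.
  by move=> h0; rewrite lee_fin; apply: mulr_ge0; [exact: U0|exact: h0].
have gVn w := Vh_ge0 _ w (a0 m%:R _ (ler0n _ _) n0).
have gVp w := Vh_ge0 _ w (a0 m%:R _ (ler0n _ _) p0).
have gUn w := Uh_ge0 _ w (a0 (m%:R * K) _ mK0 n0).
have gUp w := Uh_ge0 _ w (a0 (m%:R * K) _ mK0 p0).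
have gUr w := Uh_ge0 _ w r0.
have gU w : (0 <= (U w)%:E)%E by rewrite lee_fin.
have mXE : measurable_fun setT (fun w => (X' w ^+ m)%:E) by exact/measurable_EFinP.
have gX w : (0 <= (X' w ^+ m)%:E)%E by rewrite lee_fin exprn_ge0.
have mL : measurable_fun setT Lf.
  apply: emeasurable_funD; first exact/measurable_EFinP.
  exact: emeasurable_funD.
have mR : measurable_fun setT Rf.
  by apply: emeasurable_funD; exact: emeasurable_funD.
have LR : (\int[P]_w Lf w <= \int[P]_w Rf w)%E.
  apply: ae_ge0_le_integral => //.
  - by move=> w _; rewrite !adde_ge0.
  - by move=> w _; rewrite !adde_ge0.
  apply: filterS step => w hw _; rewrite /Lf /Rf -!EFinD lee_fin.
  have h1 : X' w ^+ m <= U w * (1 + (K * (t + Y w ^+ 2) + b w * Y w)) ^+ m.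
    by rewrite /U -exprMn lerXn2r ?nnegrE// (le_trans _ hw).
  have h2 := hC1 t (b w) (Y w); rewrite (ltW t0) tT in h2.
  have {h2} := ler_wpM2l (U0 w) (h2 isT (bK w)); rewrite -/(r (Y w)) => h2.
  have h3 := le_trans h1 h2; rewrite -subr_ge0 in h3.
  have e : b w * Y w = b w * (p (Y w) - n (Y w)) by rewrite -pn.
  rewrite -subr_ge0 (le_trans h3)// le_eqVlt; apply/orP; left; apply/eqP.
  rewrite e /V -/(U w); move: (p (Y w)) (n (Y w)) (r (Y w)) (U w) => *; ring.
have EL : (\int[P]_w Lf w = \int[P]_w (X' w ^+ m)%:E +
    (\int[P]_w (V w)%:E * \int[P]_w (m%:R * p (Y w))%:E +
     \int[P]_w (U w)%:E * \int[P]_w (m%:R * K * p (Y w))%:E))%E.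
  rewrite ge0_integralD//; last 2 first.
  - by move=> w _; rewrite adde_ge0.
  - exact: emeasurable_funD.
  rewrite ge0_integralD//.
  rewrite (Emul V (fun y => m%:R * n y))//; last 2 first.
  - exact: ma.
  - exact: a0.
  rewrite (Emul U (fun y => m%:R * K * p y))//; last 2 first.
  - exact: ma.
  - exact: a0.
  by rewrite E1.
have ER : (\int[P]_w Rf w = (\int[P]_w (U w)%:E + \int[P]_w (U w)%:E * \int[P]_w (r (Y w))%:E) +
    (\int[P]_w (V w)%:E * \int[P]_w (m%:R * p (Y w))%:E +
     \int[P]_w (U w)%:E * \int[P]_w (m%:R * K * p (Y w))%:E))%E.
  rewrite ge0_integralD//; last 4 first.
  - by move=> w _; rewrite adde_ge0.
  - exact: emeasurable_funD.
  - by move=> w _; rewrite adde_ge0.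
  - exact: emeasurable_funD.
  rewrite ge0_integralD//.
  rewrite (ge0_integralD _ _ (f1 := fun w => (V w * (m%:R * p (Y w)))%:E))//.
  rewrite (Emul U r)// (Emul V (fun y => m%:R * p y))//; last 2 first.
  - exact: ma.
  - exact: a0.
  rewrite (Emul U (fun y => m%:R * K * n y))//; last 2 first.
  - exact: ma.
  - exact: a0.
  by rewrite E2.
have I0 (h : Omega -> R) : (forall w, 0 <= h w) -> (0 <= \int[P]_w (h w)%:E)%E.
  by move=> h0; apply: integral_ge0 => w _; rewrite lee_fin.
(* Finiteness permits cancelling these common terms from both sides in the extended reals. *)
have Cfin : ((\int[P]_w (V w)%:E * \int[P]_w (m%:R * p (Y w))%:E +
     \int[P]_w (U w)%:E * \int[P]_w (m%:R * K * p (Y w))%:E) \is a fin_num)%E.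
  by rewrite fin_numD !fin_numM// ge0_fin_numE// I0// => w; rewrite ?mulr_ge0.
move: LR; rewrite EL ER leeD2rE// => /le_trans; apply.
have c0 : 0 <= C1 * C2 * t by rewrite !mulr_ge0// ltW.
rewrite EFinD (@ge0_muleDl _ _ 1%:E) ?lee_fin// mul1e.
apply: leeD => //; rewrite muleC; apply: lee_wpmul2r => //; exact: I0.
Qed.
End moment_step.

(** * The energy inequality and adaptedness *)

(** Transfers the closure properties of measurable functions to adaptedness. *)
Lemma measurable_wrtE (R : realType) disp (Omega : measurableType disp)
    (G : set (set Omega)) (X : Omega -> R) : sigma_algebra setT G ->
  measurable_wrt G X <-> measurable_fun setT (X : g_sigma_algebraType G -> R).
Proof.
move=> sG; split => [GX _ B mB|mX B mB].
  by rewrite setTI; apply: sub_sigma_algebra; exact: GX.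
by have := mX measurableT B mB; rewrite setTI /measurable/= sigma_algebra_id.
Qed.

Definition bounded_measurable {R : realType} {d} (D : set 'rV[R]_d) (v : 'rV[R]_d -> R) : Prop :=
  measurable_fun D v /\ exists c, 0 <= c /\ forall x, D x -> `|v x| <= c.

Section energy.
Context {R : realType} {d : nat} {D : set 'rV[R]_d}.
Hypotheses (d0 : (0 < d)%N) (mD : measurable D) (Dfin : (lebesgue_rV d D < +oo)%E).
Local Notation mu := (lebesgue_rV d).
Implicit Types v w z : 'rV[R]_d -> R.

Lemma inner_integrable v w : bounded_measurable D v -> bounded_measurable D w ->
  mu.-integrable D (EFin \o (fun x => v x * w x)).
Proof.
move=> [mv [c [c0 hc]]] [mw [c' [c'0 hc']]].
apply: (integrable_domain mD Dfin (c := c * c')); first exact: measurable_funM.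
by move=> x Dx; rewrite normrM ler_pM ?hc ?hc'.
Qed.

Lemma bounded_measurableD v w : bounded_measurable D v -> bounded_measurable D w ->
  bounded_measurable D (fun x => v x + w x).
Proof.
move=> [mv [c [c0 hc]]] [mw [c' [c'0 hc']]]; split; first exact: measurable_funD.
exists (c + c'); split; first exact: addr_ge0.
by move=> x Dx; rewrite (le_trans (ler_normD _ _))// lerD ?hc ?hc'.
Qed.

Lemma bounded_measurableZ (a : R) v : bounded_measurable D v ->
  bounded_measurable D (fun x => a * v x).
Proof.
move=> [mv [c [c0 hc]]]; split; first exact: measurable_funM.
exists (`|a| * c); split; first exact: mulr_ge0.
by move=> x Dx; rewrite normrM ler_wpM2l ?hc.
Qed.

Lemma inner_ge0 v : 0 <= inner D v v.
Proof. by apply: Rintegral_ge0 => x _; rewrite -expr2 sqr_ge0. Qed.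

Lemma innerC v w : inner D v w = inner D w v.
Proof. by apply: eq_Rintegral => x _; rewrite mulrC. Qed.

Lemma innerDl v w z : bounded_measurable D v -> bounded_measurable D w ->
  bounded_measurable D z ->
  inner D (fun x => v x + w x) z = inner D v z + inner D w z.
Proof.
move=> bv bw bz; rewrite /inner -RintegralD//; try exact: inner_integrable.
by apply: eq_Rintegral => x _; rewrite mulrDl.
Qed.

Lemma innerZl (a : R) v z : bounded_measurable D v -> bounded_measurable D z ->
  inner D (fun x => a * v x) z = a * inner D v z.
Proof.
move=> bv bz; rewrite /inner -RintegralZl//; last exact: inner_integrable.
by apply: eq_Rintegral => x _; rewrite mulrA.
Qed.

Lemma innerDr v w z : bounded_measurable D v -> bounded_measurable D w ->
  bounded_measurable D z ->
  inner D z (fun x => v x + w x) = inner D z v + inner D z w.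
Proof. by move=> bv bw bz; rewrite innerC innerDl// innerC (innerC w). Qed.

Lemma innerZr (a : R) v z : bounded_measurable D v -> bounded_measurable D z ->
  inner D z (fun x => a * v x) = a * inner D z v.
Proof. by move=> bv bz; rewrite innerC innerZl// innerC. Qed.

Lemma inner_sqrD v w : bounded_measurable D v -> bounded_measurable D w ->
  inner D (fun x => v x + w x) (fun x => v x + w x) =
  inner D v v + 2 * inner D v w + inner D w w.
Proof.
move=> bv bw; have bvw := bounded_measurableD bv bw.
by rewrite innerDl// !innerDr// (innerC w v); ring.
Qed.

(** Expanding 0 <= |(a + xi ga) - b|^2 absorbs half of |b|^2. Thus the noise is paired with the old
    value a, on which the increment does not depend, instead of the new value b. *)
Lemma energy_step (a b ga : 'rV[R]_d -> R) (tau G S xi C : R) :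
  bounded_measurable D a -> bounded_measurable D b -> bounded_measurable D ga ->
  0 <= tau -> 0 <= G -> S <= C ->
  inner D b b + tau * G = inner D a b + tau * S + inner D ga b * xi ->
  inner D b b <= inner D a a + 2 * tau * C + xi ^+ 2 * inner D ga ga + 2 * xi * inner D ga a.
Proof.
move=> ba bb bg tau0 G0 SC eq.
have bz := bounded_measurableZ xi bg.
have baz := bounded_measurableD ba bz.
have bnb := bounded_measurableZ (-1) bb.
have := inner_ge0 (fun x => (a x + xi * ga x) + (-1) * b x).
rewrite inner_sqrD// inner_sqrD// innerDl// !(innerZl, innerZr)// (innerC a ga).
have := mulr_ge0 tau0 G0; have := ler_wpM2l tau0 SC; move: eq.
move: (inner D b b) (inner D a a) (inner D a b) (inner D ga a) (inner D ga b) (inner D ga ga).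
move=> bbv aa ab gav gb gg; rewrite expr2; lra.
Qed.

End energy.

Section nodal_functional.
Context {R : realType} {d : nat} {D : set 'rV[R]_d}.
Hypothesis mD : measurable D.
Local Notation mu := (lebesgue_rV d).
Variable M : triangulation D.

(* The integral depends on w only through the nodal values of u w, and
   measurably so by Fubini. *)
Lemma measurable_nodal_functional disp (Omega : measurableType disp)
    (G : set (set Omega)) (u : Omega -> 'rV[R]_d -> R) (k : R -> R) :
  sigma_algebra setT G -> measurable_fun setT k -> (forall a, 0 <= k a) ->
  (forall w, piecewise_P1 M (u w)) ->
  (forall x, closure D x -> measurable_wrt G (fun w => u w x)) ->
  measurable_wrt G (fun w => \int[mu]_(x in D) k (u w x)).
Proof.
move=> sG mk k0 uP uG; have [L LP] := barycentric_cells M.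
apply/(measurable_wrtE _ sG).
pose psi (i : 'I_(nv M)) x := nodal_basis i x * \1_D x.
have mpsi i : measurable_fun setT (psi i).
  have [P1 _] := nodal_basis_spec LP i.
  have := (measurable_restrictT (nodal_basis i) mD).1 (piecewise_P1_measurable LP mD P1).
  by congr measurable_fun; apply/funext => x; rewrite /psi patchE indicE; case: ifP => _; rewrite ?mulr1 ?mulr0.
pose H (z : 'rV[R]_(nv M) * 'rV[R]_d) : \bar R :=
  (k (\sum_i z.1 0 i * psi i z.2) * \1_D z.2)%:E.
have mH : measurable_fun setT H.
  apply/measurable_EFinP; apply: measurable_funM; last first.
    by apply: measurableT_comp; [exact: measurable_indic|exact: measurable_snd].
  apply: (measurableT_comp mk); apply: measurable_sum => i.
  apply: measurable_funM; last by apply: (measurableT_comp (mpsi i)); exact: measurable_snd.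
  by apply: (measurableT_comp (measurable_coord i)); exact: measurable_fst.
have H0 z : (0 <= H z)%E by rewrite lee_fin mulr_ge0.
have mF := measurable_fun_fubini_tonelli_F (m2 := mu) H mH H0.
pose U (w : g_sigma_algebraType G) : 'rV[R]_(nv M) := \row_i u w (node i).
have mU : measurable_fun setT U.
  apply: measurable_fun_rV => i; under eq_fun do rewrite mxE.
  apply/(measurable_wrtE _ sG)/uG.
  have [K KM iK] := cells_cover_nodes i.
  by rewrite (cells_cover M); exists K => //; exact: (node_simplex LP).
have -> : (fun w : g_sigma_algebraType G => \int[mu]_(x in D) k (u w x)) =
    fine \o (fubini_F mu H \o U).
  apply/funext => w /=; rewrite /Rintegral /fubini_F; congr fine.
  rewrite integral_mkcond; apply: eq_integral => x _.
  rewrite patchE /H /= indicE; case: ifPn => xD; last by rewrite mulr0.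
  rewrite mulr1; congr (k _)%:E; rewrite inE in xD.
  rewrite (piecewise_P1_nodal LP (uP w) (subset_closure xD)).
  by apply: eq_bigr => i _; rewrite mxE /psi indicE mem_set// mulr1.
by apply: measurableT_comp => //; exact: measurableT_comp.
Qed.

End nodal_functional.

(** * The moment bound *)

Lemma bounded_domain_finite (R : realType) d (D : set 'rV[R]_d) :
  bounded_domain D -> measurable D /\ (lebesgue_rV d D < +oo)%E.
Proof.
move=> [oD _ _ [r [_ hr]]]; have mD := measurable_open_rV oD; split => //.
pose r1 := Num.max 0 (r + 1).
have rr : r < r + 1 by rewrite ltrDl.
have r10 : 0 <= r1 by rewrite le_max lexx.
apply: le_lt_trans (lebesgue_rV_cube d r10).
apply: le_measure; rewrite ?inE//; first exact: measurable_cube.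
move=> x Dx k; apply: (le_trans (ler_coord_norm x k)).
by rewrite (le_trans (hr _ rr x Dx))// le_max lexx orbT.
Qed.

Section growth.
Context {R : realType} {d : nat} {D : set 'rV[R]_d}.
Hypotheses (mD : measurable D) (Dfin : (lebesgue_rV d D < +oo)%E).
Local Notation mu := (lebesgue_rV d).
Variables (g : R -> R) (kappa : R).
Hypotheses (kappa0 : 0 <= kappa) (mg : measurable_fun setT g).
Hypothesis glip : forall a b, `|g a - g b| <= kappa * `|a - b|.

Lemma lipschitz_growth a : `|g a| <= `|g 0| + kappa * `|a|.
Proof.
rewrite -[g a](subrK (g 0)) addrC (le_trans (ler_normD _ _))// lerD2l.
by rewrite -{2}[a]subr0 glip.
Qed.

Lemma bounded_measurable_comp v : bounded_measurable D v -> bounded_measurable D (g \o v).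
Proof.
move=> [mv [c [c0 hc]]]; split; first exact: measurableT_comp.
exists (`|g 0| + kappa * c); split; first by rewrite addr_ge0// mulr_ge0.
by move=> x Dx; rewrite (le_trans (lipschitz_growth _))// lerD2l ler_wpM2l ?hc.
Qed.

Lemma inner_growth v : bounded_measurable D v ->
  inner D (g \o v) (g \o v) <=
    (2 * g 0 ^+ 2 * fine (mu D) + 2 * kappa ^+ 2) * (1 + inner D v v).
Proof.
move=> bv; have bg := bounded_measurable_comp bv.
have V0 : 0 <= fine (mu D) by exact: fine_ge0.
have I0 := @inner_ge0 _ _ D v.
have g20 := sqr_ge0 (g 0); have k20 := sqr_ge0 kappa.
have icst : mu.-integrable D (EFin \o cst (2 * g 0 ^+ 2)).
  by apply: (integrable_domain mD Dfin (c := `|2 * g 0 ^+ 2|)).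
have ikv : mu.-integrable D (EFin \o (fun x => 2 * kappa ^+ 2 * (v x * v x))).
  exact: (integrableZl mD _ (inner_integrable mD Dfin bv bv)).
apply: (@le_trans _ _ (\int[mu]_(x in D) (2 * g 0 ^+ 2 + 2 * kappa ^+ 2 * (v x * v x)))).
  apply: le_Rintegral => //.
  - exact: inner_integrable.
  - exact: (integrableD mD icst ikv).
  move=> x Dx /=; have h := lipschitz_growth (v x).
  have : g (v x) ^+ 2 <= (`|g 0| + kappa * `|v x|) ^+ 2.
    by rewrite -[g (v x) ^+ 2]real_normK ?num_real// lerXn2r ?nnegrE// addr_ge0// mulr_ge0.
  rewrite -!expr2 => /le_trans; apply.
  rewrite -[g 0 ^+ 2]real_normK ?num_real// -[v x ^+ 2]real_normK ?num_real//.
  by rewrite -mulrA -exprMn; have := sqr_ge0 (`|g 0| - kappa * `|v x|); lra.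
rewrite RintegralD// Rintegral_cst// RintegralZl//; last exact: inner_integrable.
rewrite -/(inner D v v).
have := mulr_ge0 (mulr_ge0 g20 V0) I0; have := mulr_ge0 k20 I0; lra.
Qed.

Lemma inner_young v w : bounded_measurable D v -> bounded_measurable D w ->
  `|2 * inner D v w| <= inner D v v + inner D w w.
Proof.
move=> bv bw; have bw' := bounded_measurableZ (-1) bw.
have := @inner_ge0 _ _ D (fun x => v x + w x).
have := @inner_ge0 _ _ D (fun x => v x + -1 * w x).
rewrite !inner_sqrD// !(innerZl, innerZr)// ler_norml => h1 h2; apply/andP; split; lra.
Qed.

End growth.

(** Passes from a real exponent to an integer moment; the summand 1 covers norms below 1, where
    raising the exponent would decrease the power. *)
Lemma L2norm_powR_le (R : realType) d (D : set 'rV[R]_d) v (p : R) m : 0 <= p -> p <= m%:R ->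
  L2norm D v `^ p <= (1 + inner D v v) ^+ m.
Proof.
move=> p0 pm; have I0 := @inner_ge0 _ _ D v.
have L0 : 0 <= L2norm D v by exact: sqrtr_ge0.
have LE : L2norm D v ^+ 2 = inner D v v by rewrite sqr_sqrtr.
have X1 : 1 <= (1 + inner D v v) ^+ m by rewrite exprn_ege1// lerDl.
have [L1|L1] := leP (L2norm D v) 1.
  apply: le_trans X1; rewrite -[leRHS](_ : 1 `^ p = 1); last by rewrite powR1.
  by apply: ge0_ler_powR; rewrite ?nnegrE.
apply: (@le_trans _ _ (L2norm D v `^ m%:R)); first by apply: ler_powR => //; exact: ltW.
rewrite powR_mulrn// lerXn2r ?nnegrE ?addr_ge0// -LE.
by have := sqr_ge0 (L2norm D v - 1); nra.
Qed.

(** Testing the projection with v gives |v|^2 = 2 (u0, v) - |v|^2, and 2 u0 v - v^2 <= u0^2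
    pointwise. This makes the initial moment independent of the mesh. *)
Lemma L2_projection_le (R : realType) d (D : set 'rV[R]_d) (M : triangulation D) (u0 v : 'rV[R]_d -> R) :
  measurable D -> (lebesgue_rV d D < +oo)%E -> L2 D u0 -> bounded_measurable D v ->
  L2_projection M u0 v -> inner D v v <= inner D u0 u0.
Proof.
move=> mD Dfin [mu0 iu0] bv [Vv proj].
have pE := proj v Vv.
have ivv := inner_integrable mD Dfin bv bv.
have iuu : (lebesgue_rV d).-integrable D (EFin \o (fun x => u0 x * u0 x)).
  by apply: eq_integrable iu0 => // x _; rewrite /= expr2.
have iuv : (lebesgue_rV d).-integrable D (EFin \o (fun x => u0 x * v x)).
  apply: (le_integrable mD _ _ (integrableD mD iuu ivv)).
    by apply/measurable_EFinP; apply: measurable_funM => //; case: bv.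
  move=> x Dx /=; rewrite lee_fin [leRHS]ger0_norm ?addr_ge0 -?expr2 ?sqr_ge0//.
  rewrite normrM -(@real_normK _ (u0 x)) ?num_real// -(@real_normK _ (v x)) ?num_real//.
  have := sqr_ge0 (`|u0 x| - `|v x|); have := mulr_ge0 (normr_ge0 (u0 x)) (normr_ge0 (v x)); nra.
have i2 : (lebesgue_rV d).-integrable D (EFin \o (fun x => 2 * (u0 x * v x))).
  exact: (integrableZl mD _ iuv).
have -> : inner D v v = \int[lebesgue_rV d]_(x in D) (2 * (u0 x * v x) - v x * v x).
  rewrite RintegralB// RintegralZl// -/(inner D u0 v) -/(inner D v v) -pE; ring.
apply: le_Rintegral => //; first exact: (integrableB mD i2 ivv).
by move=> x Dx; have := sqr_ge0 (u0 x - v x); rewrite -!expr2; nra.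
Qed.

Lemma measurable_L2norm_powR (R : realType) d (D : set 'rV[R]_d) disp (Omega : measurableType disp)
    (u : Omega -> 'rV[R]_d -> R) (p : R) :
  measurable_fun setT (fun w => inner D (u w) (u w)) ->
  measurable_fun setT (fun w => L2norm D (u w) `^ p).
Proof.
move=> mI; apply: (measurableT_comp (measurable_powR p)).
apply: (measurableT_comp _ mI); apply: continuous_measurable_fun; exact: sqrt_continuous.
Qed.

Section scheme.
Context {R : realType} {d q : nat} {D : set 'rV[R]_d}.
Context {disp : measure_display} {Omega : measurableType disp}.
Variables (P : probability Omega R) (F : R -> set (set Omega)) (W : R -> Omega -> R).
Variables (g : R -> R) (kappa T Cl p : R) (u0 : 'rV[R]_d -> R).
Hypotheses (d0 : (0 < d)%N) (mD : measurable D) (Dfin : (lebesgue_rV d D < +oo)%E).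
Hypotheses (hF : filtration F) (hW : wiener P F W) (T0 : 0 < T) (kappa0 : 0 <= kappa).
Hypotheses (mg : measurable_fun setT g) (glip : forall a b, `|g a - g b| <= kappa * `|a - b|).
Hypotheses (L2u0 : L2 D u0) (p0 : 0 <= p) (Cl0 : 0 <= Cl).
Hypothesis reaction : forall (I : finType) (K : {set I}) (v : I -> R), #|K| = d.+1 ->
  \sum_(i in K) \sum_(j in K) (1 + (i == j)%:R) * ((v i - v i ^+ q) * v j) <= Cl.
Local Notation mu := (lebesgue_rV d).

Let C0 := Cl * fine (mu D).
Let KA := 2 * g 0 ^+ 2 * fine (mu D) + 2 * kappa ^+ 2.
(** One constant for three roles: 2 C0 bounds the reaction, [KA] bounds |g(u)|^2 / X, and KA + 1
    bounds |B| / X by Young's inequality. *)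
Let K := 2 * C0 + KA + 1.

Let C00 : 0 <= C0. Proof. by rewrite mulr_ge0 ?fine_ge0. Qed.
Let KA0 : 0 <= KA. Proof.
apply: addr_ge0; last by rewrite mulr_ge0 ?sqr_ge0.
by apply: mulr_ge0; [rewrite mulr_ge0 ?sqr_ge0|exact: fine_ge0].
Qed.
Let K0 : 0 <= K. Proof. by rewrite addr_ge0// addr_ge0// mulr_ge0. Qed.

Section solution.
Variables (M : triangulation D) (N : nat) (u : nat -> Omega -> 'rV[R]_d -> R).
Hypotheses (N0 : (0 < N)%N) (sol : scheme_solution P F W q g u0 T M N u).

Let tau := T / N%:R.
Let tau0 : 0 < tau. Proof. by rewrite divr_gt0// ltr0n. Qed.
Let X n w := 1 + inner D (u n w) (u n w).

Let uP n w : (n <= N)%N -> piecewise_P1 M (u n w).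
Proof. by move=> nN; case: (scheme_Vh sol w nN). Qed.

Let ubm n w : (n <= N)%N -> bounded_measurable D (u n w).
Proof.
move=> nN; have [L LP] := barycentric_cells M; split.
  exact: (piecewise_P1_measurable LP mD (uP w nN)).
have [c [c0' hc]] := piecewise_P1_bounded LP (uP w nN).
by exists c; split => // x /subset_closure; exact: hc.
Qed.

Let X1 n w : 1 <= X n w. Proof. by rewrite lerDl inner_ge0. Qed.

Let tn0 n : 0 <= n%:R * tau. Proof. by rewrite mulr_ge0// ltW. Qed.

Let sF n : sigma_algebra setT (F (n%:R * tau)).
Proof. by case: hF => h _ _; exact: h. Qed.

Let FM n : F (n%:R * tau) `<=` measurable.
Proof. by case: hF => _ h _; exact: h. Qed.

Let functional_wrt (k : R -> R) n : (n <= N)%N -> measurable_fun setT k -> (forall a, 0 <= k a) ->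
  measurable_wrt (F (n%:R * tau)) (fun w => \int[mu]_(x in D) k (u n w x)).
Proof.
move=> nN mk k0; apply: (measurable_nodal_functional mD (sF n) mk k0).
  by move=> w; exact: uP.
by move=> x Dx; exact: (scheme_adapted sol nN Dx).
Qed.

Let X_wrt n : (n <= N)%N -> measurable_wrt (F (n%:R * tau)) (X n).
Proof.
move=> nN; apply/(measurable_wrtE _ (sF n)); apply: measurable_funD => //.
apply/(measurable_wrtE _ (sF n)).
apply: (functional_wrt (k := fun a => a * a) nN); first exact: measurable_funM.
by move=> a; rewrite -expr2 sqr_ge0.
Qed.

Let B n w := 2 * inner D (g \o u n w) (u n w).

(** The integrand g(u) u has no sign; polarization writes [B] through three integrals of squares, to
    which [functional_wrt] applies. *)
Let B_wrt n : (n <= N)%N -> measurable_wrt (F (n%:R * tau)) (B n).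
Proof.
move=> nN.
have -> : B n = fun w =>
    inner D (fun x => g (u n w x) + u n w x) (fun x => g (u n w x) + u n w x)
    - inner D (g \o u n w) (g \o u n w) - inner D (u n w) (u n w).
  apply/funext => w; have bu := ubm w nN.
  have bg := bounded_measurable_comp kappa0 mg glip bu.
  by rewrite (inner_sqrD mD Dfin bg bu) /B; ring.
apply/(measurable_wrtE _ (sF n)); apply: measurable_funB; first apply: measurable_funB;
  apply/(measurable_wrtE _ (sF n)).
- apply: (functional_wrt (k := fun a => (g a + a) * (g a + a)) nN).
    by apply: measurable_funM; exact: measurable_funD.
  by move=> a; rewrite -expr2 sqr_ge0.
- apply: (functional_wrt (k := fun a => g a * g a) nN); first exact: measurable_funM.
  by move=> a; rewrite -expr2 sqr_ge0.
- apply: (functional_wrt (k := fun a => a * a) nN); first exact: measurable_funM.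
  by move=> a; rewrite -expr2 sqr_ge0.
Qed.

Let B_le n w : (n <= N)%N -> `|B n w / X n w| <= K.
Proof.
move=> nN; have x0 : 0 < X n w by rewrite (lt_le_trans ltr01).
have bu := ubm w nN; have bg := bounded_measurable_comp kappa0 mg glip bu.
rewrite normrM normfV (gtr0_norm x0) ler_pdivrMr//.
apply: (le_trans (inner_young mD Dfin bg bu)).
have := inner_growth mD Dfin kappa0 mg glip bu; rewrite -/KA -/(X n w) => h.
have := mulr_ge0 C00 (ltW x0).
have : inner D (u n w) (u n w) <= X n w by rewrite lerDr.
rewrite /K; lra.
Qed.

Let xi n := increment W (n%:R * tau) (n.+1%:R * tau).

Let mxi n : measurable_fun setT (xi n).
Proof.
have mW k : measurable_fun setT (W (k%:R * tau)).
  by apply: (measurable_wrt_fun (@FM k)); exact: (wiener_adapted hW).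
exact: measurable_funB.
Qed.

Let step n : (n < N)%N ->
  {ae P, forall w, X n.+1 w <= X n w * (1 + (K * (tau + xi n w ^+ 2) + B n w / X n w * xi n w))}.
Proof.
move=> nN; apply: filterS (scheme_step sol) => w /(_ n nN) h.
have Vu := scheme_Vh sol w nN; have /= eq := h _ Vu.
have bu := ubm w (ltnW nN); have bu' := ubm w nN.
have bg := bounded_measurable_comp kappa0 mg glip bu.
have G0 : 0 <= grad_inner D (u n.+1 w) (u n.+1 w).
  by apply: sumr_ge0 => i _; exact: inner_ge0.
have SC := interpolant_reaction_bound d0 mD Dfin (f := fun a => a - a ^+ q) Cl0 reaction (uP w nN).
have en : inner D (u n.+1 w) (u n.+1 w) <= inner D (u n w) (u n w) + 2 * tau * C0
    + xi n w ^+ 2 * inner D (g \o u n w) (g \o u n w)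
    + 2 * xi n w * inner D (g \o u n w) (u n w).
  exact: (energy_step mD Dfin bu bu' bg (ltW tau0) G0 SC eq).
have x1 := X1 n w; have x0 : X n w != 0 by rewrite gt_eqF// (lt_le_trans ltr01).
rewrite [leRHS](_ : _ = X n w + K * tau * X n w + K * X n w * xi n w ^+ 2 + B n w * xi n w); last by field.
have gr := inner_growth mD Dfin kappa0 mg glip bu; rewrite -/KA -/(X n w) in gr.
have e1 : 2 * tau * C0 <= K * tau * X n w.
  rewrite [leLHS](_ : _ = (2 * C0) * tau * 1); last by ring.
  apply: ler_pM => //; first by apply: mulr_ge0; [exact: mulr_ge0|exact: ltW].
  by rewrite ler_pM2r// /K -addrA lerDl addr_ge0.
have e2 : xi n w ^+ 2 * inner D (g \o u n w) (g \o u n w) <= K * X n w * xi n w ^+ 2.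
  rewrite mulrC ler_wpM2r ?sqr_ge0//; apply: (le_trans gr).
  apply: ler_wpM2r; first exact: (le_trans ler01).
  by rewrite /K addrAC lerDr addr_ge0// mulr_ge0.
have -> : B n w * xi n w = 2 * xi n w * inner D (g \o u n w) (u n w) by rewrite /B; ring.
have XE : inner D (u n w) (u n w) = X n w - 1 by rewrite /X addrC addKr.
rewrite XE in en.
have lin (i1 x c s2 g2 k1 k2 : R) : i1 <= x - 1 + c + s2 + g2 -> c <= k1 -> s2 <= k2 ->
    1 + i1 <= x + k1 + k2 + g2 by lra.
exact: (lin _ _ _ _ _ _ _ en e1 e2).
Qed.

Lemma scheme_moment_bound m Cm : 0 <= Cm -> p <= m.+1%:R ->
  moment_growth P m.+1 K T Cm ->
  forall n, (n <= N)%N ->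
  ('E_P[fun w => (L2norm D (u n w) `^ p)%R] <=
     (expR (Cm * T) * (1 + inner D u0 u0) ^+ m.+1)%:E)%E.
Proof.
move=> Cm0 pm hstep n nN; pose Y0 := (1 + inner D u0 u0) ^+ m.+1.
have mX k : (k <= N)%N -> measurable_fun setT (X k).
  by move=> kN; exact: (measurable_wrt_fun (@FM k) (X_wrt kN)).
have Y00 : 0 <= Y0 by rewrite exprn_ge0// addr_ge0 ?inner_ge0.
have rec k : (k <= N)%N -> (\int[P]_w (X k w ^+ m.+1)%:E <= ((1 + Cm * tau) ^+ k * Y0)%:E)%E.
  elim: k => [_|k IH kN].
    rewrite expr0 mul1r.
    have -> : (Y0%:E = \int[P]_w (cst Y0%:E) w)%E.
      rewrite integral_cst// [X in (_ * X)%E](_ : _ = 1%E) ?mule1//.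
      exact: probability_setT.
    apply: ge0_le_integral => //.
    - by move=> w _; rewrite lee_fin exprn_ge0// (le_trans ler01).
    - by apply/measurable_EFinP; apply: measurable_funX; exact: mX.
    move=> w _; rewrite lee_fin; apply: lerXn2r; rewrite ?nnegrE.
    - exact: (le_trans ler01).
    - by rewrite addr_ge0 ?inner_ge0.
    rewrite lerD2l; apply: (L2_projection_le mD Dfin L2u0 (ubm w (leq0n N))).
    exact: (scheme_start sol).
  have ik := IH (ltnW kN).
  have tauT : 0 < tau <= T.
    rewrite tau0/= ler_pdivrMr ?ltr0n//.
    by apply: ler_peMr; [exact: ltW|rewrite ler1n].
  have tE : k.+1%:R * tau - k%:R * tau = tau.
    by rewrite -mulrBl -natr1 addrAC subrr add0r mul1r.
  have lt : k%:R * tau < k.+1%:R * tau by rewrite ltr_pM2r// ltr_nat.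
  apply: (le_trans (hstep (F (k%:R * tau)) (X k) (X k.+1) (fun w => B k w / X k w) (xi k) tau
    (@FM k) tauT _ _ (mX _ kN) (@mxi k) _ _ _ _ _ (step kN) _)).
  - apply/(measurable_wrtE _ (sF k)); apply: measurable_funX.
    exact/(measurable_wrtE _ (sF k))/X_wrt/ltnW.
  (* The positive exponent m + 1 absorbs the division by X and leaves a polynomial in X and B. *)
  - have -> : (fun w => X k w ^+ m.+1 * (B k w / X k w + K)) =
        fun w => X k w ^+ m * B k w + K * X k w ^+ m.+1.
      apply/funext => w; have x0 : X k w != 0 by rewrite gt_eqF// (lt_le_trans ltr01).
      by rewrite exprS; field.
    apply/(measurable_wrtE _ (sF k)).
    have m1 := (measurable_wrtE (X k) (sF k)).1 (X_wrt (ltnW kN)).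
    have m2 := (measurable_wrtE (B k) (sF k)).1 (B_wrt (ltnW kN)).
    apply: measurable_funD; apply: measurable_funM => //; exact: measurable_funX.
  - by move=> A mA; rewrite (wiener_gaussian hW (tn0 k) lt mA) tE.
  - by move=> A A' FA mA'; exact: (wiener_independent hW (tn0 k) lt FA mA').
  - by move=> w; rewrite (le_trans ler01).
  - by move=> w; rewrite (le_trans ler01).
  - by move=> w; exact: (B_le w (ltnW kN)).
  - exact: (le_lt_trans ik (ltry _)).
  rewrite exprS -mulrA EFinM; apply: lee_wpmul2l => //.
  by rewrite lee_fin addr_ge0// mulr_ge0// ltW.
rewrite unlock; apply: (@le_trans _ _ (\int[P]_w (X n w ^+ m.+1)%:E)%E).
  apply: ge0_le_integral => //.
  - by move=> w _; rewrite lee_fin powR_ge0.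
  - apply/measurable_EFinP; apply: measurable_L2norm_powR.
    have -> : (fun w => inner D (u n w) (u n w)) = (fun w => X n w - 1).
      by apply/funext => w; rewrite /X addrC addKr.
    by apply: measurable_funB => //; exact: mX.
  - by apply/measurable_EFinP; apply: measurable_funX; exact: mX.
  by move=> w _; rewrite lee_fin; exact: L2norm_powR_le.
apply: (le_trans (rec n nN)); rewrite lee_fin ler_wpM2r//.
have c1 : 1 <= 1 + Cm * tau by rewrite lerDl mulr_ge0// ltW.
apply: (@le_trans _ _ ((1 + Cm * tau) ^+ N)); first by rewrite ler_weXn2l.
have -> : Cm * T = N%:R * (Cm * tau) by rewrite /tau; field; rewrite pnatr_eq0 -lt0n.
rewrite expRM_natl lerXn2r ?nnegrE ?expR_ge0 ?(le_trans ler01)//.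
exact: expR_ge1Dx.
Qed.

End solution.
End scheme.

Theorem theorem3p4 (R : realType) (d q : nat)
  (hq : (3 <= q)%N) (oddq : odd q)
  (hd : d = 2%N \/ (d = 3%N /\ (q = 3%N \/ q = 5%N)))
  (D : set 'rV[R]_d) (hD : bounded_domain D) (T : R) (hT : 0 < T)
  (disp : measure_display) (Omega : measurableType disp)
  (P : probability Omega R) (F : R -> set (set Omega)) (hF : filtration F)
  (W : R -> Omega -> R) (hW : wiener P F W)
  (g : R -> R) (gderivable : forall a, derivable g a 1)
  (gC1 : continuous (derive1 g)) (kappa1 : R) (hkappa1 : 0 < kappa1)
  (glip : forall a b, `|g a - g b| <= kappa1 * `|a - b|)
  (u0 : 'rV[R]_d -> R) (hu0 : sobolev D 2 u0)
  (Th : set (triangulation D)) (hTh : shape_regular Th)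
  (hmesh : forall M, Th M -> mesh_assumption M)
  (p : R) (hp : 2 <= p) :
  exists2 C : R, 0 < C &
    forall (M : triangulation D), Th M -> forall N : nat, (0 < N)%N ->
    forall u : nat -> Omega -> 'rV[R]_d -> R,
    scheme_solution P F W q g u0 T M N u ->
    (ereal_sup [set 'E_P[fun w => (L2norm D (u l w) `^ p)%R] | l in `I_N.+1]
       <= C%:E)%E.
Proof.
have [mD Dfin] := bounded_domain_finite hD.
have d0 : (0 < d)%N by case: hd => [->|[-> _]].
have [Cl hCl] := simplex_reaction_bound R hq oddq hd.
have reaction (I : finType) (K : {set I}) (v : I -> R) : #|K| = d.+1 ->
    \sum_(i in K) \sum_(j in K) (1 + (i == j)%:R) * ((v i - v i ^+ q) * v j) <= `|Cl|.
  by move=> /hCl h; apply: (le_trans (h v)); exact: ler_norm.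
have mg : measurable_fun setT g.
  apply: continuous_measurable_fun => a.
  exact/differentiable_continuous/derivable1_diffP.
have p0 : 0 <= p by apply: le_trans hp.
(* The same K as for a single solution, formed before any mesh or solution is introduced, so that
   [Cm] depends on neither. *)
pose K := 2 * (`|Cl| * fine (lebesgue_rV d D))
  + (2 * g 0 ^+ 2 * fine (lebesgue_rV d D) + 2 * kappa1 ^+ 2) + 1.
have V0 : 0 <= fine (lebesgue_rV d D) by exact: fine_ge0.
have K0 : 0 <= K.
  apply: addr_ge0 => //; apply: addr_ge0; first by rewrite !mulr_ge0.
  apply: addr_ge0; last by rewrite mulr_ge0 ?sqr_ge0.
  by apply: mulr_ge0 => //; rewrite mulr_ge0 ?sqr_ge0.
(* Truncation may fall below p; hence the moment of order m + 1. *)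
pose m := Num.truncn p.
have pm : p <= m.+1%:R by rewrite ltW// truncnS_gt.
have [Cm Cm0 hCm] := moment_step P m.+1 K0 hT.
have I0 := @inner_ge0 _ _ D u0.
exists (expR (Cm * T) * (1 + inner D u0 u0) ^+ m.+1).
  by rewrite mulr_gt0 ?expR_gt0// exprn_gt0// ltr_wpDr.
move=> M _ N N0 u sol; apply: ge_ereal_sup => _ [l /= lN <-].
apply: (scheme_moment_bound d0 mD Dfin hF hW hT (ltW hkappa1) mg glip hu0.1 p0 _ reaction N0 sol Cm0 pm hCm) => //.
Qed.
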